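(* Let $\mathcal{X},\mathcal{Y}$ be Polish spaces, and consider the partially observed Markov process (POMP) with transition kernel $T:\mathcal{X}\to\mathcal{P}(\mathcal{X})$ and measurement kernel $Q:\mathcal{X}\to\mathcal{P}(\mathcal{Y})$. Assume that $Q$ is dominated, and let $\alpha=(1-\delta(T))(2-\delta(Q))$. (1) If $\alpha<1$, then the filter is exponentially stable in total variation in expectation with coefficient $\alpha$, and for all $\mu,\nu\in\mathcal{P}(\mathcal{X})$ with $\mu\ll\nu$ and all $n\in\{0,1,2,\dots\}$, $$E^{\mu}\big[\|\pi_{n}^{\mu}-\pi_{n}^{\nu}\|_{TV}\big]\le(2-\delta(Q))\,\alpha^{n}\,\|\mu-\nu\|_{TV}.$$ (2) If $\delta(T)>\frac12$, then $\alpha<1$ and the POMP is exponentially stable in total variation in expectation, regardless of the (dominated) measurement kernel $Q$.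
   Context: $\mathcal{P}(S)$ denotes the set of Borel probability measures on a Polish space $S$. Process: for a prior $\mu\in\mathcal{P}(\mathcal{X})$, $P^\mu$ (with expectation $E^\mu$) is the law on $\mathcal{X}^{\mathbb{Z}_+}\times\mathcal{Y}^{\mathbb{Z}_+}$ of the Markov chain $\{(X_n,Y_n)\}_{n\ge0}$ with $P^\mu((X_0,Y_0)\in A)=\int_A Q(dy|x)\mu(dx)$ and $P^\mu((X_n,Y_n)\in A\mid (X,Y)_{[0,n-1]}=(x,y)_{[0,n-1]})=\int_A Q(dy|x_n)T(dx_n|x_{n-1})$. The kernels are time invariant. Write $T(\pi)(dx')=\int_{\mathcal{X}}T(dx'|x)\pi(dx)$ for a measure $\pi$ on $\mathcal{X}$. Dominated: $Q$ is dominated if there is $\lambda\in\mathcal{P}(\mathcal{Y})$ with $Q(dy|x)\ll\lambda$ for every $x\in\mathcal{X}$; $g(x,y)=\frac{dQ(\cdot|x)}{d\lambda}(y)$ denotes the (jointly measurable) likelihood function. Bayesian update operator: $\psi(\pi,y)(dx)=\frac{g(x,y)\pi(dx)}{\int_{\mathcal{X}}g(x',y)\pi(dx')}$ if the denominator is positive, and $\psi(\pi,y)=0$ (zero measure) otherwise. Filter: $\pi_n^\mu(\cdot)=P^\mu(X_n\in\cdot\mid Y_{[0,n]})$, where $Y_{[0,n]}=(Y_0,\dots,Y_n)$. It is computed recursively by $\pi_0^\mu=\psi(\mu,Y_0)$, $\pi_{n+1}^\mu=\psi(T(\pi_n^\mu),Y_{n+1})$. The incorrectly initialized filter $\pi_n^\nu$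 is computed by the same recursion started from $\pi_0^\nu=\psi(\nu,Y_0)$, using the same measurements; in $E^\mu$ the measurements are generated under $P^\mu$. Exponential stability: the POMP (or filter) is exponentially stable in total variation in expectation if there is a coefficient $0<\alpha<1$ such that for any $\mu\ll\nu$, $E^\mu[\|\pi_{n+1}^\mu-\pi_{n+1}^\nu\|_{TV}]\le\alpha E^\mu[\|\pi_n^\mu-\pi_n^\nu\|_{TV}]$ for all $n\in\{0,1,\dots\}$; ''with coefficient $\alpha$'' means that this inequality holds with that particular $\alpha$ (in the degenerate case $\alpha=0$ the inequality is read with $\alpha=0$). Total variation norm: $\|P-P'\|_{TV}=\sup_{\|f\|_\infty\le 1}\left|\int f\,dP-\int f\,dP'\right|$, the supremum being over measurable real functions $f$ with $\|f\|_\infty\le1$. Dobrushin coefficient: for a probability kernel $K:S_1\to\mathcal{P}(S_2)$, $\delta(K)=\inf\sum_{i=1}^{m}\min(K(x,A_i),K(x',A_i))$, where the infimum is over all $x,x'\in S_1$ and all finite measurable partitions $\{A_i\}_{i=1}^m$ of $S_2$. *)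

(* Defs.v *)
From HB Require Import structures.
From mathcomp Require Import all_boot all_order all_algebra.
From mathcomp Require Import all_classical all_reals all_analysis.
From mathcomp Require Import measurable_realfun.

Set Implicit Arguments.
Unset Strict Implicit.
Unset Printing Implicit Defensive.

Import Order.TTheory GRing.Theory Num.Theory.
Import numFieldNormedType.Exports.

Local Open Scope classical_set_scope.
Local Open Scope ring_scope.
Local Open Scope ereal_scope.

(* A Polish space is presented together with a compatible complete metric: for
   a pseudometric, being a metric amounts to being Hausdorff. *)
Definition polish (R : realType) (X : completePseudoMetricType R) : Prop :=
  hausdorff_space X /\ exists2 D : set X, countable D & dense D.

Notation borel X := (g_sigma_algebraType (@open X)).

(* cylinder sets; they generate the product sigma-algebra on S^N *)
Definition cylinders d (S : measurableType d) : set (set (nat -> S)) :=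
  \bigcup_n preimage_set_system [set: nat -> S] (fun s => s n) measurable.

Arguments cylinders {d} S.

Notation seqspace S := (g_sigma_algebraType (cylinders S)).

(* generators of the sigma-algebra of Z_0, ..., Z_n *)
Definition events_upto d (S : measurableType d) (Om : Type)
    (Z : nat -> Om -> S) (n : nat) : set (set Om) :=
  \bigcup_(k in `I_n.+1) preimage_set_system [set: Om] (Z k) measurable.

(* f is a version of the conditional probability P(E | <<s G >>) *)
Definition is_cond_prob (R : realType) d (Om : measurableType d)
    (P : probability Om R) (G : set (set Om)) (E : set Om) (f : Om -> \bar R) :=
  measurable_fun [set: g_sigma_algebraType G] f /\
  (forall B, <<s G >> B -> \int[P]_(w in B) f w = P (E `&` B)).

Section dobrushin.
Context (R : realType) d1 d2 (S1 : measurableType d1) (S2 : measurableType d2).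

Definition measurable_partition m (A : 'I_m -> set S2) :=
  [/\ forall i, measurable (A i), trivIset [set: 'I_m] A
    & \bigcup_i A i = [set: S2]].

Definition dobrushin (K : R.-pker S1 ~> S2) : R :=
  inf [set r : R | exists x x' m (A : 'I_m -> set S2), measurable_partition A /\
    r = (\sum_(i < m) Num.min (fine (K x (A i))) (fine (K x' (A i))))%R].

End dobrushin.

Definition tv_norm (R : realType) d (X : measurableType d)
    (P P' : subprobability X R) : \bar R :=
  ereal_sup [set `|\int[P]_x (f x)%:E - \int[P']_x (f x)%:E| | f in
    [set f : X -> R | measurable_fun setT f /\ forall x, (`|f x| <= 1)%R]].

Section predict.
Context (R : realType) d (X : measurableType d).
Variables (T : R.-pker X ~> X) (pi : subprobability X R).

(* T(pi)(dx') = \int T(dx' | x) pi(dx) *)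
Definition predict (A : set X) : \bar R := \int[pi]_x T x A.

Let predict0 : predict set0 = 0.
Proof. by apply: integral0_eq => x _; rewrite measure0. Qed.

Let predict_ge0 A : 0 <= predict A.
Proof. exact: integral_ge0. Qed.

Let predict_sigma_additive : semi_sigma_additive predict.
Proof.
move=> F mF tF mUF.
rewrite [X in _ --> X](_ : _ = \int[pi]_x (\sum_(n <oo) T x (F n))); last first.
  apply: eq_integral => x _.
  by apply/esym/cvg_lim => //; exact: measure_semi_sigma_additive.
rewrite integral_nneseries//; last by move=> n; exact: measurable_kernel.
apply: is_cvg_nneseries => n _ _; exact: integral_ge0.
Qed.

HB.instance Definition _ := isMeasure.Build _ _ _ predict
  predict0 predict_ge0 predict_sigma_additive.

Let predict_le1 : predict setT <= 1.
Proof.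
rewrite /predict (eq_integral (cst 1)); last by move=> x _; rewrite prob_kernel.
by rewrite integral_cst// mul1e sprobability_setT.
Qed.

HB.instance Definition _ :=
  Measure_isSubProbability.Build _ _ _ predict predict_le1.

End predict.

(* a jointly measurable version g(x, y) of dQ(.|x)/dlam(y) *)
Record likelihood (R : realType) dx dy (X : measurableType dx)
    (Y : measurableType dy) (Q : R.-pker X ~> Y) (lam : probability Y R) :=
  Likelihood {
    likelihood_fun :> X * Y -> R ;
    likelihood_ge0 : forall z, (0 <= likelihood_fun z)%R ;
    likelihood_measurable : measurable_fun [set: X * Y] likelihood_fun ;
    likelihoodE : forall x A, measurable A ->
      Q x A = \int[lam]_(y in A) (likelihood_fun (x, y))%:E }.

Section bayes.
Context (R : realType) dx dy (X : measurableType dx) (Y : measurableType dy).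
Variables (Q : R.-pker X ~> Y) (lam : probability Y R) (g : likelihood Q lam).
Variables (pi : subprobability X R) (y : Y).

Definition normalizer : \bar R := \int[pi]_x (g (x, y))%:E.

(* If the normalizer is +oo (which can happen only for y in a lam-null set),
   then its inverse is read as 0. *)
Definition bayes_density (x : X) : R :=
  if 0 < normalizer then (g (x, y) / fine normalizer)%R else 0%R.

(* the update psi(pi, y); it is the zero measure if the normalizer is 0 *)
Definition bayes (A : set X) : \bar R := \int[pi]_(x in A) (bayes_density x)%:E.

Let measurable_gy : measurable_fun [set: X] (fun x => g (x, y)).
Proof.
exact: measurableT_comp (likelihood_measurable g) (pair2_measurable y).
Qed.

Let normalizer_ge0 : 0 <= normalizer.
Proof. by apply: integral_ge0 => x _; rewrite lee_fin likelihood_ge0. Qed.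

Let bayes_density_ge0 x : 0 <= (bayes_density x)%:E.
Proof.
rewrite /bayes_density; case: ifPn => // _.
by rewrite lee_fin divr_ge0 ?likelihood_ge0 ?fine_ge0.
Qed.

Let measurable_bayes_density :
  measurable_fun [set: X] (fun x => (bayes_density x)%:E).
Proof.
apply/measurable_EFinP; rewrite /bayes_density.
by case: (0 < normalizer); [apply: measurable_funM|].
Qed.

Let bayes0 : bayes set0 = 0.
Proof. exact: integral_set0. Qed.

Let bayes_ge0 A : 0 <= bayes A.
Proof. exact: integral_ge0. Qed.

Let bayes_sigma_additive : semi_sigma_additive bayes.
Proof.
move=> F mF tF mUF; rewrite /bayes ge0_integral_bigcup//; last first.
  exact: measurable_funTS.
by apply: is_cvg_nneseries => n _ _; exact: integral_ge0.
Qed.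

HB.instance Definition _ := isMeasure.Build _ _ _ bayes
  bayes0 bayes_ge0 bayes_sigma_additive.

Let bayes_le1 : bayes setT <= 1.
Proof.
rewrite /bayes /bayes_density; have [N0|_] := boolP (0 < normalizer);
  last by rewrite integral0_eq.
rewrite (eq_integral (fun x => (fine normalizer)^-1%:E * (g (x, y))%:E));
  last by move=> x _; rewrite mulrC EFinM.
rewrite ge0_integralZl//; last 3 first.
- exact/measurable_EFinP.
- by move=> x _; rewrite lee_fin likelihood_ge0.
- by rewrite lee_fin invr_ge0 fine_ge0.
rewrite -/normalizer; move: N0; case: normalizer => [r| |]//=.
- by rewrite lte_fin => r0; rewrite -EFinM mulVf// gt_eqF.
- by rewrite invr0 mul0e.
Qed.

HB.instance Definition _ :=
  Measure_isSubProbability.Build _ _ _ bayes bayes_le1.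

End bayes.

Section pomp.
Context (R : realType) dx dy (X : measurableType dx) (Y : measurableType dy).
Variables (T : R.-pker X ~> X) (Q : R.-pker X ~> Y).

Let trajectory := (seqspace X * seqspace Y)%type.

Definition state (n : nat) (w : trajectory) : X := w.1 n.
Definition observation (n : nat) (w : trajectory) : Y := w.2 n.
Definition state_obs (n : nat) (w : trajectory) : X * Y :=
  (state n w, observation n w).

(* \int_A Q(dy | x) m(dx) *)
Definition joint (m : probability X R) (A : set (X * Y)) : \bar R :=
  \int[m]_x Q x (xsection A x).

(* P is the law P^mu of the chain *)
Definition is_pomp_law (mu : probability X R) (P : probability trajectory R) :=
  (forall A, measurable A -> P (state_obs 0 @^-1` A) = joint mu A) /\
  (forall n A, measurable A ->
     is_cond_prob P (events_upto state_obs n) (state_obs n.+1 @^-1` A)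
       (fun w => \int[T (state n w)]_x Q x (xsection A x))).

(* pi n is a version of the conditional law of X_n given Y_0, ..., Y_n. It may
   fail to have mass 1 on a null set, so that the recursion filter_rec below,
   where the update can return the zero measure, qualifies as a version. *)
Definition is_filter (P : probability trajectory R)
    (pi : nat -> trajectory -> subprobability X R) :=
  forall n A, measurable A ->
    is_cond_prob P (events_upto observation n) (state n @^-1` A)
      (fun w => pi n w A).

Variables (lam : probability Y R) (g : likelihood Q lam).

Fixpoint filter_rec (nu : probability X R) (n : nat) (w : trajectory) :
    subprobability X R :=
  match n with
  | 0 => bayes g nu (observation 0 w)
  | m.+1 => bayes g (predict T (filter_rec nu m w)) (observation m.+1 w)
  end.

Definition expected_error (P : probability trajectory R)
    (pi : nat -> trajectory -> subprobability X R) (nu : probability X R) (n : nat) :=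
  \int[P]_w tv_norm (pi n w) (filter_rec nu n w).

Definition exp_stable_with (alpha : R) :=
  forall (mu nu : probability X R), mu `<< nu ->
  forall P, is_pomp_law mu P -> forall pi, is_filter P pi ->
  forall n, expected_error P pi nu n.+1 <= alpha%:E * expected_error P pi nu n.

Definition exp_stable :=
  exists alpha : R, (0 < alpha < 1)%R /\ exp_stable_with alpha.

End pomp.

(* Main.v *)
From HB Require Import structures.
Require Import Defs.
From mathcomp Require Import all_boot all_order all_algebra.
From mathcomp Require Import all_classical all_reals all_analysis.
From mathcomp Require Import measurable_realfun giry ring lra.

(** The filters are updated in two half-steps, prediction by T and Bayesian
    correction by the new observation, and each half-step has a simple effect on
    the total variation distance.

    Prediction contracts: pushing two probabilities through a kernel K multiplies
    their distance by at most 1 - dobrushin K (dobrushin_contraction).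

    Correction may expand, but by at most 2 - dobrushin Q in expectation
    (bayes_contraction). Let m and m' be the two predictions and N, N' their
    normalizers, that is, the densities with respect to lam of the laws that they
    predict for the observation. When the observation is y, the difference of the
    corrections, multiplied by N(y), is
      g(., y) (m - m') + (1 - N(y) / N'(y)) g(., y) m'.
    The observation is really drawn with density N, so the expected distance of
    the corrections is the integral in y of the norm of this measure. The first
    term contributes at most the distance of m and m'. The second one contributes
    the integral of |N - N'|, which is the distance between the images of m and
    m' under Q, hence at most 1 - dobrushin Q times the distance of m and m'.

    The expected error is thus multiplied by at most alpha at each step
    (next_error), and the first correction, which no prediction precedes,
    contributes the factor 2 - dobrushin Q of the explicit bound (initial_error).
    Since dobrushin Q >= 0, alpha is below 1 as soon as dobrushin T > 1/2.

    The remaining work gives a meaning to these expectations. The total variation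
    distance of two random measures is measurable because the Borel
    sigma-algebra of a separable space is generated by a countable algebra
    (measurable_tv_norm). The filter is characterized by its conditional
    probabilities only, so the recursion started from mu has to be shown to
    compute it (bayes_cond_law, filter_invariant), and almost surely as a measure
    and not just set by set (expected_errorE). Finally, the normalizers are
    almost surely positive and finite, for the wrong filter because the true one
    remains absolutely continuous with respect to it (comparable_bayes). *)

Set Implicit Arguments.
Unset Strict Implicit.
Unset Printing Implicit Defensive.

Import Order.TTheory GRing.Theory Num.Theory.
Import numFieldNormedType.Exports.

Local Open Scope classical_set_scope.
Local Open Scope ring_scope.
Local Open Scope ereal_scope.

(** * Densities, kernels and conditional laws *)

Section density.
Context d (T : measurableType d) (R : realType).
Variables (m l : {measure set T -> \bar R}) (g : T -> R).
Hypotheses (mg : measurable_fun [set: T] g) (g0 : forall x, (0 <= g x)%R).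
Hypothesis mE : forall A, measurable A -> m A = \int[l]_(x in A) (g x)%:E.

Import HBNNSimple.

(** By monotone convergence along simple functions, the claim reduces to
    indicators, where it is the hypothesis. The density is real-valued, so that
    multiplication by it commutes with limits even where f is infinite. *)
Lemma ge0_integral_density f : measurable_fun [set: T] f ->
  (forall x, 0 <= f x) -> \int[m]_x f x = \int[l]_x (f x * (g x)%:E).
Proof.
move=> mf f0.
have mEg : measurable_fun [set: T] (EFin \o g) by exact/measurable_EFinP.
have Eg0 x : 0 <= (g x)%:E by rewrite lee_fin.
pose h := nnsfun_approx measurableT mf.
have mh n : measurable_fun [set: T] (EFin \o h n) by exact/measurable_EFinP.
have cvgh x : EFin \o h ^~ x @ \oo --> f x by exact: cvg_nnsfun_approx.
have ndh x : {homo (fun n => (h n x)%:E) : n k / (n <= k)%N >-> n <= k}.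
  by move=> n k nk; rewrite lee_fin; exact/lefP/nd_nnsfun_approx.
transitivity (limn (fun n => \int[m]_x (h n x)%:E)).
  rewrite -monotone_convergence//; first by apply: eq_integral => x _;
    apply/esym/cvg_lim => //; exact: cvgh.
  by move=> n x _; rewrite lee_fin.
transitivity (limn (fun n => \int[l]_x ((h n x)%:E * (g x)%:E))); last first.
  rewrite -monotone_convergence//.
  - apply: eq_integral => x _; apply/cvg_lim => //.
    by apply: cvgeZr => //; exact: cvgh.
  - by move=> j; apply: emeasurable_funM => //; exact/measurable_EFinP.
  - by move=> j x _; rewrite mule_ge0// lee_fin.
  - by move=> x _ j k jk; rewrite lee_wpmul2r//; exact: ndh.
congr (limn _); apply/funext => n.
transitivity (\int[m]_x (\sum_(y \in range (h n))
    (y * \1_(h n @^-1` [set y]) x)%:E)).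
  by apply: eq_integral => x _; rewrite fimfunE -fsumEFin.
have mind r : measurable_fun [set: T]
    (fun x => (r * \1_(h n @^-1` [set r]) x)%:E).
  by apply/measurable_EFinP; exact: measurable_funM.
rewrite ge0_integral_fsum//; last by move=> r x _; exact: nnfun_muleindic_ge0.
transitivity (\int[l]_x (\sum_(y \in range (h n))
    (y * \1_(h n @^-1` [set y]) x)%:E * (g x)%:E)); last first.
  apply: eq_integral => x _.
  rewrite -ge0_mule_fsuml => [|y]; last exact: nnfun_muleindic_ge0.
  by rewrite fsumEFin// -fimfunE.
rewrite ge0_integral_fsum//; last 2 first.
  - by move=> y; exact: emeasurable_funM.
  - by move=> r x _; rewrite mule_ge0// nnfun_muleindic_ge0.
apply: eq_fsbigr => r /[!inE] -[z _ rE].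
have r0 : (0 <= r)%R by rewrite -rE.
under eq_integral do rewrite EFinM.
rewrite ge0_integralZl//; last by apply/measurable_EFinP.
under [RHS]eq_integral do rewrite EFinM -muleA.
rewrite ge0_integralZl//; last 2 first.
- by apply: emeasurable_funM => //; exact/measurable_EFinP.
- by move=> x _; rewrite mule_ge0// lee_fin.
congr (_ * _); rewrite integral_indic// setIT mE//.
rewrite integral_mkcond; apply: eq_integral => x _.
by rewrite (epatch_indic (EFin \o g)) muleC.
Qed.

End density.

Section kernel_giry.
Context d1 d2 (S1 : measurableType d1) (S2 : measurableType d2) (R : realType).
Variable K : R.-spker S1 ~> S2.

(** A name for the values of the kernel, to which the structure of a
    subprobability can be attached. *)
Definition kernel_measure (x : S1) : set S2 -> \bar R := K x.

HB.instance Definition _ x := Measure.on (kernel_measure x).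

HB.instance Definition _ x := Measure_isSubProbability.Build _ _ _
  (kernel_measure x) (sprob_kernel_le1 K x).

Definition giry_of_kernel (x : S1) : giry S2 R := kernel_measure x.

Lemma measurable_giry_of_kernel : measurable_fun [set: S1] giry_of_kernel.
Proof.
by apply: measurable_giry_codensity => // B mB; exact: measurable_kernel.
Qed.

End kernel_giry.

Section parametrized_integral.
Context d1 d2 (S1 : measurableType d1) (S2 : measurableType d2) (R : realType).
Variables (k : S1 -> giry S2 R) (mk : measurable_fun [set: S1] k).

Lemma measurable_giry_pair :
  measurable_fun [set: S1] (fun x => giry_prod (giry_ret x, k x)).
Proof.
apply: (measurableT_comp measurable_giry_prod).
by apply/measurable_fun_pair => //; exact: measurable_giry_ret.
Qed.

(** Tensoring with a Dirac mass turns an integral with a parameter into the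
    integral of one function against a measure depending measurably on that
    parameter; this is how every joint measurability below is obtained. *)
Lemma giry_int_pair (h : S1 * S2 -> \bar R) x :
  measurable_fun [set: S1 * S2] h -> (forall z, 0 <= h z) ->
  giry_int (giry_prod (giry_ret x, k x)) h = \int[k x]_y h (x, y).
Proof.
move=> mh h0; rewrite giry_int_prod1// giry_int_ret//.
apply: (measurable_fun_fubini_tonelli_F _ mh) => //.
Qed.

Lemma measurable_integral_param (h : S1 * S2 -> \bar R) :
  measurable_fun [set: S1 * S2] h -> (forall z, 0 <= h z) ->
  measurable_fun [set: S1] (fun x => \int[k x]_y h (x, y)).
Proof.
move=> mh h0; under eq_fun do rewrite -giry_int_pair//.
apply: (measurableT_comp (measurable_giry_int mh h0)).
exact: measurable_giry_pair.
Qed.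

End parametrized_integral.

Lemma giry_bindE d1 d2 (S1 : measurableType d1) (S2 : measurableType d2)
    (R : realType) (m : giry S1 R) (k : S1 -> giry S2 R)
    (mk : measurable_fun [set: S1] k) A :
  measurable A -> giry_bind m mk A = \int[m]_x k x A.
Proof.
move=> mA; rewrite [LHS](giry_int_map mk m (measurable_giry_ev mA))//.
Qed.

Section disintegration.
Context d dO dZ (Om : measurableType d) (O : measurableType dO)
  (Z : measurableType dZ) (R : realType).
Variables (P : probability Om R) (u : Om -> O) (v : Om -> Z) (k : O -> giry Z R).
Hypotheses (mu : measurable_fun [set: Om] u) (mv : measurable_fun [set: Om] v).
Hypothesis mk : measurable_fun [set: O] k.
Hypothesis kP : forall B A, measurable B -> measurable A ->
  \int[P]_(w in u @^-1` B) k (u w) A = P (v @^-1` A `&` u @^-1` B).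

(** The law of (u, v) and the measure built from the law of u and the family k
    agree on rectangles by hypothesis, hence everywhere by uniqueness of
    measures on a generating pi-system. The conditioning variable u is kept
    general: below it is the identity from a space to the same space with a
    smaller sigma-algebra. *)
Lemma disintegration (h : O * Z -> \bar R) :
  measurable_fun [set: O * Z] h -> (forall z, 0 <= h z) ->
  \int[P]_w h (u w, v w) = \int[P]_w \int[k (u w)]_z h (u w, z).
Proof.
move=> mh h0.
have mf : measurable_fun [set: Om] (fun w => (u w, v w)).
  exact/measurable_fun_pair.
pose Pu : giry O R := giry_map mu P.
pose m1 : giry (O * Z)%type R := giry_map mf P.
pose m2 : giry (O * Z)%type R := giry_bind Pu (measurable_giry_pair mk).
have m12 A : measurable A -> m1 A = m2 A.
  apply: (measure_unique [set A `*` B | A in measurable & B in measurable]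
            (fun=> setT)) => //.
  - exact: measurable_prod_measurableType.
  - move=> _ _ [A1 mA1 [A2 mA2 <-]] [B1 mB1 [B2 mB2 <-]].
    exists (A1 `&` B1); first exact: measurableI.
    exists (A2 `&` B2); first exact: measurableI.
    by rewrite setXI.
  - by move=> _; exists setT => //; exists setT => //; rewrite setXTT.
  - by rewrite bigcup_const.
  - move=> _ [B mB [C mC <-]].
    have mBC : measurable (B `*` C) by exact: measurableX.
    transitivity (P (v @^-1` C `&` u @^-1` B)).
      by congr (P _); apply/seteqP; split => w [].
    rewrite -kP//.
    have mF := measurableT_comp (measurable_giry_ev mBC) (measurable_giry_pair mk).
    apply: (etrans _ (esym (giry_bindE Pu (measurable_giry_pair mk) mBC))).
    rewrite -[RHS]/(giry_int Pu
      (giry_ev^~ (B `*` C) \o (fun x => giry_prod (giry_ret x, k x)))).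
    rewrite giry_int_map//.
    rewrite integral_mkcond; apply: eq_integral => w _ /=.
    rewrite [RHS]product_measure1E//.
    transitivity ((u w \in B)%:R%:E * k (u w) C); last first.
      by congr (_ * _); rewrite -[RHS]/(\d_(u w) B) diracE.
    rewrite patchE (_ : (w \in _) = (u w \in B)).
      by case: (u w \in B); rewrite ?mul1e ?mul0e.
    by apply/idP/idP; rewrite !inE.
  - by move=> _; rewrite (le_lt_trans (@sprobability_setT _ _ _ m1))// ltry.
transitivity (giry_int m1 h); first by rewrite giry_int_map.
transitivity (giry_int m2 h).
  by apply: eq_measure_integral => A mA _; exact: m12.
rewrite giry_int_bind// giry_int_map//.
- by apply: eq_integral => w _; rewrite /= giry_int_pair.
- apply: (measurableT_comp (measurable_giry_int mh h0)).
  exact: measurable_giry_pair.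
- by move=> w; exact: integral_ge0.
Qed.

End disintegration.

Section cond_law.
Context d dZ (Om : measurableType d) (Z : measurableType dZ) (R : realType).
Variables (P : probability Om R) (G : set (set Om)).

(** The family k is a version of the conditional law of V given the
    sigma-algebra generated by G. *)
Definition is_cond_law (Z' : Om -> Z) (k : Om -> giry Z R) :=
  forall A, measurable A -> is_cond_prob P G (Z' @^-1` A) (fun w => k w A).

Local Notation Og := (g_sigma_algebraType G).

Lemma measurable_id_coarse : G `<=` measurable ->
  measurable_fun [set: Om] (id : Om -> Og).
Proof.
move=> mG _ B mB; rewrite setTI.
exact: (smallest_sub (@sigma_algebra_measurable _ Om) mG).
Qed.

Variables (Z' : Om -> Z) (k : Om -> giry Z R).
Hypotheses (mG : G `<=` measurable) (mZ' : measurable_fun [set: Om] Z').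
Hypothesis kP : is_cond_law Z' k.

Lemma measurable_cond_law : measurable_fun [set: Og] (k : Og -> giry Z R).
Proof. by apply: measurable_giry_codensity => // B /kP[]. Qed.

(** Conditioning freezes the part of h that is measurable for the conditioning
    sigma-algebra and averages the rest against the conditional law. *)
Lemma cond_law_integral (h : Og * Z -> \bar R) :
  measurable_fun [set: Og * Z] h -> (forall z, 0 <= h z) ->
  \int[P]_w h (w, Z' w) = \int[P]_w \int[k w]_z h (w, z).
Proof.
apply: (disintegration (measurable_id_coarse mG) mZ' measurable_cond_law).
by move=> B A mB /kP[_ ->].
Qed.

End cond_law.

(** * Total variation distance through sets *)

Lemma sub_eq_add (R : realType) (a b p q : \bar R) :
  a \is a fin_num -> b \is a fin_num -> p \is a fin_num -> q \is a fin_num ->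
  (a - b = p - q) <-> (a + q = b + p).
Proof.
move: a b p q => [a| |] [b| |] [p| |] [q| |]//= _ _ _ _.
by rewrite -!EFinD; split=> -[h]; congr EFin; lra.
Qed.

Section total_variation.
Context d (T : measurableType d) (R : realType).

(** The value at the test function that has modulus one and takes, on A and on
    its complement, the signs of the differences: the total variation distance
    is the supremum of these values. *)
Definition set_dist (m m' : subprobability T R) (A : set T) : \bar R :=
  `|m A - m' A| + `|m (~` A) - m' (~` A)|.

Lemma subprob_fin_num (m : subprobability T R) A : measurable A -> m A \is a fin_num.
Proof. by move=> mA; exact: fin_num_measure. Qed.

(** The Jordan decomposition of m - m', stated without subtraction so that it
    can be integrated against nonnegative functions of infinite integral. *)
Lemma jordan_pair (m m' : subprobability T R) : exists p q : {finite_measure set T -> \bar R},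
  (forall A, measurable A -> m A + q A = m' A + p A) /\
  exists2 S, measurable S & p setT + q setT = set_dist m m' S.
Proof.
pose nu : {charge set T -> \bar R} := cadd (charge_of_finite_measure m)
                (cscale (-1) (charge_of_finite_measure m')).
have nuE A : nu A = m A - m' A.
  by rewrite /nu/= /cadd/= cscaleN1 /charge_of_finite_measure.
have [S [N SN]] := Hahn_decomposition nu.
exists (jordan_pos SN), (jordan_neg SN); split.
  move=> A mA.
  apply/sub_eq_add; rewrite ?fin_num_measure//.
  by rewrite -nuE (jordan_decomp SN mA) /cadd/= cscaleN1.
have [[mS posS] [mN negN] SNT SN0] := SN.
have NE : N = ~` S.
  apply/seteqP; split => [x Nx Sx|x Sx].
    by have : (S `&` N) x by []; rewrite SN0.
  have : (S `|` N) x by rewrite SNT.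
  by case.
exists S => //.
have pE : jordan_pos SN [set: T] = nu S.
  transitivity (crestr0 nu mS [set: T]) => //.
  by rewrite /crestr0 mem_set// /crestr setTI.
have qE : jordan_neg SN [set: T] = - nu N.
  transitivity (cscale (-1) (crestr0 nu mN) [set: T]) => //.
  by rewrite cscaleN1/= /crestr0 mem_set// /crestr setTI.
transitivity (nu S - nu N); first exact: (f_equal2 _ pE qE).
rewrite /set_dist -!nuE -NE.
rewrite gee0_abs; last exact: posS.
by rewrite lee0_abs//; exact: negN.
Qed.

Lemma bounded_integrable (m : {finite_measure set T -> \bar R}) (u : T -> R) (r : R) :
  measurable_fun setT u -> (forall x, (`|u x| <= r)%R) ->
  m.-integrable setT (EFin \o u).
Proof.
move=> mu ur; apply: measurable_bounded_integrable => //.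
  by rewrite ltey_eq fin_num_measure.
exists r; split; first exact: num_real.
by move=> s rs x _; exact: le_trans (ur x) (ltW rs).
Qed.

Lemma eq_measure_integral_add (m m' p q : {measure set T -> \bar R}) f D :
  measurable D -> (forall A, measurable A -> m A + q A = m' A + p A) ->
  \int[measure_add m q]_(x in D) f x = \int[measure_add m' p]_(x in D) f x.
Proof.
move=> mD mqE; apply: eq_measure_integral => A mA _.
exact: etrans (measure_addE _ _ _) (etrans (mqE A mA) (esym (measure_addE _ _ _))).
Qed.

(** The difference of the two integrals is the difference of the integrals
    against q and p, each of which is controlled by the total mass. *)
Lemma integral_diff_le (m m' : subprobability T R) (p q : {finite_measure set T -> \bar R})
    (u : T -> R) (r : R) :
  (forall A, measurable A -> m A + q A = m' A + p A) ->
  measurable_fun setT u -> (forall x, (`|u x| <= r)%R) ->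
  `|\int[m]_x (u x)%:E - \int[m']_x (u x)%:E| <= r%:E * (p setT + q setT).
Proof.
move=> mqE mu ur.
have r0 : (0 <= r)%R by exact: le_trans (normr_ge0 _) (ur point).
have iu (n : {finite_measure set T -> \bar R}) := bounded_integrable n mu ur.
have fu (n : {finite_measure set T -> \bar R}) :
  \int[n]_x (u x)%:E \is a fin_num by exact: integrable_fin_num (iu n).
have ub (n : {finite_measure set T -> \bar R}) :
    `|\int[n]_x (u x)%:E| <= r%:E * n setT.
  rewrite -[leRHS]integral_cst//.
  apply: (le_trans (le_abse_integral _ _ _)) => //; first exact: measurable_int (iu n).
  apply: ge0_le_integral => //.
  - by apply: measurableT_comp => //; exact: measurable_int (iu n).
  - by move=> x _; rewrite lee_fin.
have E : \int[m]_x (u x)%:E + \int[q]_x (u x)%:E =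
         \int[m']_x (u x)%:E + \int[p]_x (u x)%:E.
  rewrite -(integral_measure_add _ (iu m) (iu q))//.
  rewrite -(integral_measure_add _ (iu m') (iu p))//.
  exact: eq_measure_integral_add.
have {E} -> : \int[m]_x (u x)%:E - \int[m']_x (u x)%:E =
    \int[p]_x (u x)%:E - \int[q]_x (u x)%:E.
  exact/sub_eq_add.
rewrite ge0_muleDr// (le_trans (lee_abs_sub _ _))// leeD//; exact: ub.
Qed.

Lemma set_dist_le (m m' : subprobability T R) A : measurable A -> set_dist m m' A <= tv_norm m m'.
Proof.
move=> mA; have mCA := measurableC mA.
have I (n : subprobability T R) (s t : R) :
    \int[n]_x (s * \1_A x + t * \1_(~` A) x)%:E = s%:E * n A + t%:E * n (~` A).
  under eq_integral do rewrite EFinD !EFinM.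
  have i B : measurable B -> n.-integrable setT (fun x => (\1_B x)%:E).
    by move=> mB; apply: integrable_indic => //; rewrite ltey_eq fin_num_measure.
  rewrite integralD//; [|exact/integrableZl/i|exact/integrableZl/i].
  by rewrite !integralZl ?integral_indic ?setIT//; exact: i.
pose sg (x : R) := if (0 <= x)%R then 1%R else (-1)%R : R.
have sgE x : (sg x * x = `|x|)%R.
  by rewrite /sg; case: ifPn => [/ger0_norm ->|]; [rewrite mul1r|
    rewrite -ltNge => /ltr0_norm ->; rewrite mulN1r].
have sg1 x : (`|sg x| = 1)%R by rewrite /sg; case: ifPn; rewrite ?normrN1 ?normr1.
pose s := sg (fine (m A) - fine (m' A))%R.
pose t := sg (fine (m (~` A)) - fine (m' (~` A)))%R.
apply: le_ereal_sup_tmp => /=.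
exists (`|\int[m]_x (s * \1_A x + t * \1_(~` A) x)%:E -
          \int[m']_x (s * \1_A x + t * \1_(~` A) x)%:E|).
  exists (fun x => s * \1_A x + t * \1_(~` A) x)%R => //; split.
    by apply: measurable_funD; apply: measurable_funM.
  move=> x; rewrite !indicE in_setC; case: (x \in A) => /=.
    by rewrite mulr1 mulr0 addr0 sg1.
  by rewrite mulr1 mulr0 add0r sg1.
rewrite !I /set_dist /s /t.
move: (subprob_fin_num m mA) (subprob_fin_num m' mA)
  (subprob_fin_num m mCA) (subprob_fin_num m' mCA).
move: (m A) (m' A) (m (~` A)) (m' (~` A)).
move=> [a| |] [b| |] [a'| |] [b'| |]//= _ _ _ _.
rewrite lee_fin -(sgE (a - b)%R) -(sgE (a' - b')%R); set s1 := sg _; set s2 := sg _.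
by apply: le_trans (ler_norm _); rewrite le_eqVlt; apply/orP; left; apply/eqP; ring.
Qed.

Lemma tv_normP (m m' : subprobability T R) : exists p q : {finite_measure set T -> \bar R},
  (forall A, measurable A -> m A + q A = m' A + p A) /\
  p setT + q setT = tv_norm m m'.
Proof.
have [p [q [mqE [S mS pqS]]]] := jordan_pair m m'.
exists p, q; split => //; apply/eqP; rewrite eq_le pqS set_dist_le//= -pqS.
apply: ge_ereal_sup => _ [f [mf f1] <-].
by rewrite -[leRHS]mul1e; exact: integral_diff_le.
Qed.

(** The supremum is reached on a Hahn set of the difference. To bound a total
    variation distance it is therefore enough to look at two-set partitions. *)
Lemma tv_norm_attained (m m' : subprobability T R) :
  exists2 S, measurable S & tv_norm m m' = set_dist m m' S.
Proof.
have [p [q [mqE [S mS pqS]]]] := jordan_pair m m'.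
exists S => //; apply/eqP; rewrite eq_le set_dist_le// andbT -pqS.
apply: ge_ereal_sup => _ [f [mf f1] <-].
by rewrite -[leRHS]mul1e; exact: integral_diff_le.
Qed.

Lemma tv_norm_ge0 (m m' : subprobability T R) : 0 <= tv_norm m m'.
Proof. by have [S _ ->] := tv_norm_attained m m'; rewrite adde_ge0. Qed.

Lemma integral_diff_tv (m m' : subprobability T R) (u : T -> R) (r : R) :
  measurable_fun setT u -> (forall x, (`|u x| <= r)%R) ->
  `|\int[m]_x (u x)%:E - \int[m']_x (u x)%:E| <= r%:E * tv_norm m m'.
Proof.
by have [p [q [mqE <-]]] := tv_normP m m'; exact: integral_diff_le.
Qed.

Lemma tv_norm_le (m m' : subprobability T R) c :
  (forall A, measurable A -> set_dist m m' A <= c) -> tv_norm m m' <= c.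
Proof. by have [S mS ->] := tv_norm_attained m m'; exact. Qed.

Lemma eq_tv_norm (m m' n n' : subprobability T R) :
  (forall A, measurable A -> m A = n A) ->
  (forall A, measurable A -> m' A = n' A) -> tv_norm m m' = tv_norm n n'.
Proof.
move=> mn mn'.
have E A : measurable A -> set_dist m m' A = set_dist n n' A.
  by move=> mA; rewrite /set_dist !mn ?mn'//; exact: measurableC.
apply/eqP; rewrite eq_le; apply/andP; split; apply: tv_norm_le => A mA.
  by rewrite E// set_dist_le.
by rewrite -E// set_dist_le.
Qed.

End total_variation.

(** * Countably generated sigma-algebras *)

Section countable_algebra.
Context {T : Type}.
Variable G : nat -> set T.

(** Trees labelled by natural numbers form a countable type, so that reading
    them as Boolean expressions in the sets G n enumerates the algebra generated
    by these sets. *)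
Fixpoint bool_comb (t : GenTree.tree nat) : set T :=
  match t with
  | GenTree.Leaf n => G n
  | GenTree.Node _ [::] => set0
  | GenTree.Node _ [:: a] => ~` bool_comb a
  | GenTree.Node _ (a :: b :: _) => bool_comb a `|` bool_comb b
  end.

Definition alg_seq (n : nat) : set T :=
  if unpickle n is Some t then bool_comb t else set0.

Lemma alg_seq_comb t : exists n, alg_seq n = bool_comb t.
Proof. by exists (pickle t); rewrite /alg_seq pickleK. Qed.

Lemma comb_alg_seq n : exists t, alg_seq n = bool_comb t.
Proof.
by rewrite /alg_seq; case: unpickle => [t|]; [exists t|exists (GenTree.Node 0 [::])].
Qed.

Lemma alg_seq_gen k : exists n, alg_seq n = G k.
Proof. exact: (alg_seq_comb (GenTree.Leaf k)). Qed.

Lemma alg_seq0 : exists n, alg_seq n = set0.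
Proof. exact: (alg_seq_comb (GenTree.Node 0 [::])). Qed.

Lemma alg_seqC k : exists n, alg_seq n = ~` alg_seq k.
Proof.
by have [t ->] := comb_alg_seq k; exact: (alg_seq_comb (GenTree.Node 0 [:: t])).
Qed.

Lemma alg_seqU j k : exists n, alg_seq n = alg_seq j `|` alg_seq k.
Proof.
have [s ->] := comb_alg_seq j; have [t ->] := comb_alg_seq k.
exact: (alg_seq_comb (GenTree.Node 0 [:: s; t])).
Qed.

Lemma alg_seqI j k : exists n, alg_seq n = alg_seq j `&` alg_seq k.
Proof.
have [j' j'E] := alg_seqC j; have [k' k'E] := alg_seqC k.
have [u uE] := alg_seqU j' k'; have [n nE] := alg_seqC u.
by exists n; rewrite nE uE j'E k'E setCU !setCK.
Qed.

End countable_algebra.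

Section countably_generated.
Context d (T : measurableType d) (R : realType).
Variable G : nat -> set T.
Hypothesis GE : @measurable d T = <<s range G >>.

Lemma measurable_alg_seq n : measurable (alg_seq G n).
Proof.
have mG k : measurable (G k) by rewrite GE; apply: sub_sigma_algebra; exists k.
have [t ->] := comb_alg_seq G n.
move: t; fix IH 1 => -[k|k [|a [|b s]]] /=.
- exact: mG.
- exact: measurable0.
- exact/measurableC/IH.
- by apply: measurableU; exact: IH.
Qed.

Lemma measurable_alg_gen : @measurable d T = <<s range (alg_seq G) >>.
Proof.
apply/seteqP; split.
  rewrite GE; apply: smallest_sub; first exact: smallest_sigma_algebra.
  move=> _ [k _ <-]; have [n <-] := alg_seq_gen G k.
  by apply: sub_sigma_algebra; exists n.
apply: smallest_sub; first exact: sigma_algebra_measurable.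
by move=> _ [n _ <-]; exact: measurable_alg_seq.
Qed.

(** Two measures agreeing on countably many sets agree everywhere. This turns
    the almost sure equality of the measures of each set, with an exceptional
    event depending on the set, into the almost sure equality of the measures. *)
Lemma eq_measure_alg_seq (m m' : {measure set T -> \bar R}) :
  m setT < +oo -> (forall n, m (alg_seq G n) = m' (alg_seq G n)) ->
  forall A, measurable A -> m A = m' A.
Proof.
move=> moo mm' A mA.
apply: (measure_unique (range (alg_seq G)) (fun=> setT)) => //.
- exact: measurable_alg_gen.
- move=> _ _ [j _ <-] [k _ <-].
  by have [n <-] := alg_seqI G j k; exists n.
- move=> _; have [n0 n0E] := alg_seq0 G; have [n nE] := alg_seqC G n0.
  by exists n => //; rewrite nE n0E setC0.
- by rewrite bigcup_const.
- by move=> _ [n _ <-].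
Qed.

Section approximation.
Variable m : {measure set T -> \bar R}.
Hypothesis moo : m setT < +oo.

Let sdiff (A B : set T) := (A `\` B) `|` (B `\` A).

Let m_sdiff A B : measurable A -> measurable B -> measurable (sdiff A B).
Proof. by move=> mA mB; apply: measurableU; exact: measurableD. Qed.

Let approx A :=
  measurable A /\
  forall e : R, (0 < e)%R -> exists n, m (sdiff A (alg_seq G n)) < e%:E.

Let approx_alg k : approx (alg_seq G k).
Proof.
split; first exact: measurable_alg_seq.
by move=> e e0; exists k; rewrite /sdiff setDv setU0 measure0 lte_fin.
Qed.

Let approxC A : approx A -> approx (~` A).
Proof.
move=> [mA hA]; split; first exact: measurableC.
move=> e /hA[n hn]; have [k kE] := alg_seqC G n; exists k.
suff -> : sdiff (~` A) (alg_seq G k) = sdiff A (alg_seq G n) by [].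
by rewrite /sdiff kE !setDE !setCK setUC (setIC A) (setIC _ (~` A)).
Qed.

Let approxU A B : approx A -> approx B -> approx (A `|` B).
Proof.
move=> [mA hA] [mB hB]; split; first exact: measurableU.
move=> e e0; have e20 : (0 < e / 2)%R by rewrite divr_gt0.
have [j hj] := hA _ e20; have [k hk] := hB _ e20.
have [n nE] := alg_seqU G j k; exists n.
have mj := measurable_alg_seq j; have mk := measurable_alg_seq k.
apply: (@le_lt_trans _ _ (m (sdiff A (alg_seq G j)) + m (sdiff B (alg_seq G k)))).
  apply: le_trans (measureU2 _ _ _); [|exact: m_sdiff..].
  apply: le_measure; rewrite ?inE.
  - by apply: m_sdiff; [exact: measurableU|exact: measurable_alg_seq].
  - by apply: measurableU; exact: m_sdiff.
  - rewrite nE /sdiff => x /=; tauto.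
by rewrite [e]splitr EFinD lteD.
Qed.

Let approx_bigcup (F : (set T)^nat) :
  (forall n, approx (F n)) -> approx (\bigcup_n F n).
Proof.
move=> hF; have mF n : measurable (F n) by have [] := hF n.
have mU : measurable (\bigcup_n F n) by exact: bigcup_measurable.
split=> // e e0; have e20 : (0 < e / 2)%R by rewrite divr_gt0.
pose H n := \big[setU/set0]_(i < n) F i.
have hH n : approx (H n).
  elim: n => [|n ih]; last by rewrite /H big_ord_recr; exact: approxU.
  by rewrite /H big_ord0; have [k <-] := alg_seq0 G.
pose D n := (\bigcup_n F n) `\` H n.
have mD n : measurable (D n) by apply: measurableD => //; have [] := hH n.
have : m (D n) @[n --> \oo] --> m (\bigcap_n D n).
  apply: nonincreasing_cvg_mu => //.
  - apply: le_lt_trans moo; apply: le_measure; rewrite ?inE//.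
  - exact: bigcapT_measurable.
  - move=> a b ab; apply/subsetPset; apply: setDS.
    exact: subset_bigsetU.
rewrite (_ : \bigcap_n D n = set0) ?measure0; last first.
  rewrite -subset0 => x hx; have [[k _ Fkx] _] := hx 0%N Logic.I.
  have [_] := hx k.+1 Logic.I; apply.
  by rewrite /H big_ord_recr; right.
move=> /fine_cvgP[_ /cvgr_lt/(_ _ e20)[N _ /(_ N (leqnn _))/= DN]].
have {}DN : m (D N) < (e / 2)%:E.
  rewrite -[m (D N)]fineK ?lte_fin// ge0_fin_numE//.
  by rewrite (le_lt_trans _ moo)// le_measure ?inE.
have [mH /(_ _ e20)[n hn]] := hH N; exists n.
have mn := measurable_alg_seq n.
apply: (@le_lt_trans _ _ (m (D N) + m (sdiff (H N) (alg_seq G n)))).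
  apply: le_trans (measureU2 _ _ _); [|exact: mD|exact: m_sdiff].
  apply: le_measure; rewrite ?inE.
  - exact: m_sdiff.
  - by apply: measurableU; [exact: mD|exact: m_sdiff].
  - have HU x : H N x -> (\bigcup_n F n) x.
      by rewrite /H -bigcup_mkord => -[k _ Fkx]; exists k.
    rewrite /D /sdiff => x /=; have := HU x.
    by have [] := pselect (H N x); tauto.
by rewrite [e]splitr EFinD lteD.
Qed.

(** The sets that can be approximated in measure by members of a generating
    algebra form a sigma-algebra: a countable union is first replaced by a
    finite one. *)
Lemma measure_approx A : measurable A -> forall e : R, (0 < e)%R ->
  exists n, m (A `\` alg_seq G n) + m (alg_seq G n `\` A) < e%:E.
Proof.
move=> mA e e0.
suff [_ /(_ e e0)[n hn]] : approx A.
  exists n; rewrite -measureU//.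
  - exact: measurableD mA (measurable_alg_seq n).
  - exact: measurableD (measurable_alg_seq n) mA.
  - by rewrite -subset0 => x [[Ax nx] [nx' _]].
move: mA; rewrite GE; move: A; apply: smallest_sub.
  split.
  - have [k <-] := alg_seq0 G; exact: approx_alg.
  - by move=> A hA; rewrite setTD; exact: approxC.
  - exact: approx_bigcup.
by move=> _ [k _ <-]; have [n <-] := alg_seq_gen G k; exact: approx_alg.
Qed.

End approximation.

(** Approximating a set in m + m' by a member of the algebra changes
    set_dist by an arbitrarily small amount. *)
Lemma tv_norm_sup (m m' : subprobability T R) :
  tv_norm m m' = ereal_sup (range (fun n => set_dist m m' (alg_seq G n))).
Proof.
apply/eqP; rewrite eq_le; apply/andP; split; last first.
  by apply: ge_ereal_sup => _ [n _ <-]; apply: set_dist_le; exact: measurable_alg_seq.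
apply: tv_norm_le => A mA; apply/lee_addgt0Pr => /= e e0.
have mmoo : measure_add m m' setT < +oo.
  by rewrite measure_addE lte_add_pinfty// ltey_eq fin_num_measure.
have e20 : (0 < e / 2)%R by rewrite divr_gt0.
have [n] := measure_approx mmoo mA e20.
set C := alg_seq G n; have mC : measurable C by exact: measurable_alg_seq.
have mAC : measurable (A `\` C) by exact: measurableD.
have mCA : measurable (C `\` A) by exact: measurableD.
have mI : measurable (A `&` C) by exact: measurableI.
have mcU : measurable (~` (A `|` C)) by apply: measurableC; exact: measurableU.
have dA : A = (A `&` C) `|` (A `\` C) by rewrite setUIDK.
have dC : C = (A `&` C) `|` (C `\` A) by rewrite setIC setUIDK.
have dcA : ~` A = ~` (A `|` C) `|` (C `\` A).
  by apply/seteqP; split => x /=; have := pselect (C x); tauto.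
have dcC : ~` C = ~` (A `|` C) `|` (A `\` C).
  by apply/seteqP; split => x /=; have := pselect (A x); tauto.
move=> hn0.
have hn : m (A `\` C) + m' (A `\` C) + (m (C `\` A) + m' (C `\` A)) < (e / 2)%:E.
  apply: le_lt_trans hn0; rewrite le_eqVlt; apply/orP; left; apply/eqP.
  exact: (f_equal2 _ (esym (measure_addE m m' _)) (esym (measure_addE m m' _))).
apply: (@le_trans _ _ (set_dist m m' C + e%:E)); last first.
  by rewrite leeD2r//; apply: ereal_sup_ubound; exists n.
have mE (l : subprobability T R) : [/\ l A = l (A `&` C) + l (A `\` C),
    l C = l (A `&` C) + l (C `\` A),
    l (~` A) = l (~` (A `|` C)) + l (C `\` A) &
    l (~` C) = l (~` (A `|` C)) + l (A `\` C)].
  split; [rewrite {1}dA|rewrite {1}dC|rewrite {1}dcA|rewrite {1}dcC];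
    rewrite measureU// -subset0 => x /=; tauto.
rewrite /set_dist.
have [-> -> -> ->] := mE m; have [-> -> -> ->] := mE m'.
have f (l : subprobability T R) B : measurable B ->
    exists2 r : R, (0 <= r)%R & l B = r%:E.
  move=> mB; exists (fine (l B)); first by rewrite fine_ge0.
  by rewrite fineK// fin_num_measure.
move: hn.
have [a a0 ->] := f m _ mAC; have [b b0 ->] := f m' _ mAC.
have [c c0 ->] := f m _ mCA; have [c' c'0 ->] := f m' _ mCA.
have [i _ ->] := f m _ mI; have [i' _ ->] := f m' _ mI.
have [u _ ->] := f m _ mcU; have [u' _ ->] := f m' _ mcU.
rewrite -!EFinD lte_fin lee_fin => h.
have t1 : (`|i + a - (i' + b)| <= `|i + c - (i' + c')| + (a + b + c + c'))%R.
  rewrite (_ : i + a - (i' + b) = (i + c - (i' + c')) + (a - b - c + c'))%R; last ring.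
  rewrite (le_trans (ler_normD _ _))// lerD2l ler_norml; apply/andP; split; lra.
have t2 : (`|u + c - (u' + c')| <= `|u + a - (u' + b)| + (a + b + c + c'))%R.
  rewrite (_ : u + c - (u' + c') = (u + a - (u' + b)) + (b - a + c - c'))%R; last ring.
  rewrite (le_trans (ler_normD _ _))// lerD2l ler_norml; apply/andP; split; lra.
lra.
Qed.

(** Without this, the expected errors would only be lower integrals, which are
    not additive and do not respect the changes of variables made below. *)
Lemma measurable_tv_norm :
  measurable_fun [set: giry T R * giry T R] (fun x => tv_norm x.1 x.2).
Proof.
pose f n (x : giry T R * giry T R) := set_dist x.1 x.2 (alg_seq G n).
rewrite (_ : (fun x => _) = (fun x => esups (f ^~ x) 0%N)); last first.
  apply/funext => x; rewrite tv_norm_sup /esups/= /sdrop/=.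
  by congr ereal_sup; apply/seteqP; split => _ [n _ <-]; exists n.
apply: measurable_fun_esups => n.
have mg B : measurable B -> measurable_fun [set: giry T R * giry T R]
    (fun x => x.1 B - x.2 B).
  move=> mB; apply: emeasurable_funB.
    exact: (measurableT_comp (measurable_giry_ev mB) measurable_fst).
  exact: (measurableT_comp (measurable_giry_ev mB) measurable_snd).
apply: emeasurable_funD; apply: measurableT_comp => //; apply: mg.
  exact: measurable_alg_seq.
exact/measurableC/measurable_alg_seq.
Qed.

End countably_generated.

(** Every open set is the union of the members of a countable family of open
    sets that it contains. A ball of a pseudometric need not be open, hence the
    interiors. Centres in the dense set are indexed through an injection into
    the natural numbers, so that each G n is a union over at most one centre. *)
Lemma borel_countably_generated (R : realType) (X : completePseudoMetricType R) :
  polish X ->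
  exists G : nat -> set X, @measurable _ (borel X) = <<s range G >>.
Proof.
move=> [_ [D /pcard_injP[h hinj] dD]].
pose G0 (jk : nat * nat) : set X :=
  \bigcup_(x in [set x | D x /\ h x = jk.1]) (ball x (jk.2.+1%:R^-1 : R)%R)°.
have oG0 jk : open (G0 jk) by apply: bigcup_open => x _; exact: open_interior.
exists (fun n => G0 (odflt (0, 0)%N (unpickle n))).
apply/seteqP; split; last first.
  apply: smallest_sub; first exact: smallest_sigma_algebra.
  by move=> _ [n _ <-]; apply: sub_sigma_algebra; exact: oG0.
apply: smallest_sub; first exact: smallest_sigma_algebra.
move=> U oU.
rewrite (_ : U = \bigcup_n (if `[< G0 (odflt (0, 0)%N (unpickle n)) `<=` U >]
    then G0 (odflt (0, 0)%N (unpickle n)) else set0)); last first.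
  apply/seteqP; split => [x Ux|x [n _]]; last by case: asboolP => // + Gx; exact.
  have : nbhs x U by exact: open_nbhs_nbhs.
  rewrite -nbhs_ballE => -[e /= e0 xeU].
  have e20 : (0 < e / 2)%R by rewrite divr_gt0.
  have [k ke] : exists k, (k.+1%:R^-1 < e / 2 :> R)%R.
    by have [k _ /(_ k (leqnn _))] := near_infty_natSinv_lt (PosNum e20); exists k.
  have k0 : (0 < k.+1%:R^-1 :> R)%R by rewrite invr_gt0.
  have oB : open_nbhs x (ball x (k.+1%:R^-1 / 2)%R)°.
    split; first exact: open_interior.
    by apply: nbhsx_ballx; rewrite divr_gt0.
  have [y [By Dy]] : (ball x (k.+1%:R^-1 / 2)%R)° `&` D !=set0.
    by apply: dD; [exists x; exact: oB.2|exact: oB.1].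
  have {}By : ball x (k.+1%:R^-1 / 2)%R y by exact: interior_subset.
  exists (pickle (h y, k)) => //; rewrite pickleK/=.
  have xG : G0 (h y, k) x.
    exists y => //; rewrite /interior; apply: (filterS (P := ball x (k.+1%:R^-1 / 2)%R)).
      move=> z xz; have := ball_triangle (ball_sym By) xz.
      by rewrite -splitr.
    by apply: nbhsx_ballx; rewrite divr_gt0.
  case: asboolP => // -[] z [y' [Dy' /= hy'] /interior_subset y'z].
  move: y'z; rewrite (_ : y' = y); last by apply: hinj; rewrite ?inE.
  move=> yz; apply: xeU; apply: le_ball (ball_triangle By yz).
  by move: ke k0; set r := (k.+1%:R^-1)%R; lra.
apply: sigma_algebra_bigcup => n; case: asboolP => _; last exact: sigma_algebra0.
by apply: sub_sigma_algebra; exists n.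
Qed.

(** * Contraction by the Dobrushin coefficient *)

Section dobrushin_contraction.
Context d1 d2 (S1 : measurableType d1) (S2 : measurableType d2) (R : realType).
Variable K : R.-pker S1 ~> S2.

Let overlaps := [set r : R | exists x x' n (A : 'I_n -> set S2),
  measurable_partition A /\
  r = (\sum_(i < n) Num.min (fine (K x (A i))) (fine (K x' (A i))))%R].

Let overlaps_lb : lbound overlaps 0%R.
Proof.
move=> _ [x [x' [n [A [_ ->]]]]]; apply: sumr_ge0 => i _.
by rewrite le_min !fine_ge0.
Qed.

Lemma dobrushin_overlap x x' A : measurable A ->
  (dobrushin K <= Num.min (fine (K x A)) (fine (K x' A)) +
    Num.min (fine (K x (~` A))) (fine (K x' (~` A))))%R.
Proof.
move=> mA; apply: ge_inf; first by exists 0%R; exact: overlaps_lb.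
exists x, x', 2%N, (fun i => if i == ord0 then A else ~` A); split; last first.
  by rewrite big_ord_recl big_ord1.
split=> [i|i j _ _|].
- by case: ifP => _ //; exact: measurableC.
- by case: i j => [[|[|//]] ?] [[|[|//]] ?] /= [y []] //= ? ?; exact/val_inj.
- rewrite -subTset => y _; have [Ay|Ay] := pselect (A y).
    by exists ord0.
  by exists (lift ord0 ord0).
Qed.

Lemma dobrushin_ge0 : (0 <= dobrushin K)%R.
Proof.
apply: lb_le_inf => //.
exists (\sum_(i < 1) Num.min (fine (K point setT)) (fine (K point setT)))%R.
exists point, point, 1%N, (fun=> setT); split => //.
split=> // [i j _ _ _|]; first by rewrite (ord1 i) (ord1 j).
by rewrite bigcup_const//; exists ord0.
Qed.

Lemma dobrushin_le1 : (dobrushin K <= 1)%R.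
Proof.
have := @dobrushin_overlap point point set0 measurable0.
by rewrite setC0 measure0 prob_kernel minxx minxx add0r.
Qed.

Let K1 x : K x setT = 1. Proof. exact: prob_kernel. Qed.

Let fK x A : measurable A -> (fine (K x A))%:E = K x A.
Proof. by move=> mA; rewrite fineK//; exact: finite_kernel_measure. Qed.

Let KC x A : measurable A -> fine (K x (~` A)) = (1 - fine (K x A))%R.
Proof.
move=> mA; have mCA := measurableC mA.
have : K x A + K x (~` A) = 1.
  rewrite -(K1 x) -(setUv A); apply/esym/measureU => //; exact: setICr.
by rewrite -(fK x mA) -(fK x mCA) -EFinD => -[]; lra.
Qed.

(** The overlap of the partition into A and its complement is at most
    K x' A + 1 - K x A. *)
Lemma dobrushin_oscillation x x' A : measurable A ->
  (fine (K x A) - fine (K x' A) <= 1 - dobrushin K)%R.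
Proof.
move=> mA; have mCA := measurableC mA.
have := dobrushin_overlap x x' mA.
have : (Num.min (fine (K x A)) (fine (K x' A)) <= fine (K x' A))%R.
  by rewrite ge_min lexx orbT.
have : (Num.min (fine (K x (~` A))) (fine (K x' (~` A))) <= 1 - fine (K x A))%R.
  by rewrite ge_min KC// lexx.
lra.
Qed.

(** As x varies, K x A stays in an interval of length 1 - dobrushin K. Adding a
    constant to a function does not change the difference of its integrals
    against two probabilities, so 2 (K x A) may be replaced by a function bounded
    by 1 - dobrushin K, and the two summands on the left are equal. *)
Lemma dobrushin_contraction (m m' : subprobability S1 R) A :
  m setT = 1 -> m' setT = 1 -> measurable A ->
  `|\int[m]_x K x A - \int[m']_x K x A| +
  `|\int[m]_x K x (~` A) - \int[m']_x K x (~` A)| <=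
  (1 - dobrushin K)%:E * tv_norm m m'.
Proof.
move=> m1 m'1 mA; have mCA := measurableC mA.
pose u x := fine (K x A).
have mu : measurable_fun setT u.
  by apply: measurableT_comp => //; exact: measurable_kernel.
have u01 x : (0 <= u x <= 1)%R.
  rewrite fine_ge0//= -lee_fin fK// -(K1 x).
  by apply: le_measure; rewrite ?inE.
(* The midpoint of an interval of length 2 (1 - dobrushin K) with right end
   2 sup u, which contains all values of 2 u. *)
pose c := (2 * sup (range u) - (1 - dobrushin K))%R.
have us x : (u x <= sup (range u))%R.
  apply: ub_le_sup; last by exists x.
  by exists 1%R => _ [z _ <-]; have /andP[] := u01 z.
have su x : (sup (range u) <= u x + (1 - dobrushin K))%R.
  apply: ge_sup; first by exists (u x), x.
  by move=> _ [z _ <-]; rewrite -lerBlDl; exact: dobrushin_oscillation.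
have uc x : (`|2 * u x - c| <= 1 - dobrushin K)%R.
  by rewrite ler_norml /c; have := us x; have := su x; lra.
have mu2 : measurable_fun setT (fun x => 2 * u x - c)%R.
  by apply: measurable_funB => //; exact: measurable_funM.
have iu (l : subprobability S1 R) : l.-integrable setT (EFin \o u).
  apply: (@bounded_integrable _ _ _ _ u 1) => // x.
  by rewrite ger0_norm; have /andP[] := u01 x.
have Iu (l : subprobability S1 R) : l setT = 1 -> exists a : R,
    [/\ \int[l]_x K x A = a%:E, \int[l]_x K x (~` A) = (1 - a)%:E &
        \int[l]_x (2 * u x - c)%:E = (2 * a - c)%:E].
  move=> l1; exists (fine (\int[l]_x (u x)%:E)).
  have aE : \int[l]_x (u x)%:E = (fine (\int[l]_x (u x)%:E))%:E.
    by rewrite fineK//; exact: integrable_fin_num (iu l).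
  have ic r : l.-integrable setT (EFin \o cst r).
    exact: finite_measure_integrable_cst.
  have cE r : \int[l]_x (cst r x)%:E = r%:E.
    apply: etrans (integral_cst l measurableT r%:E) _.
    by rewrite -[RHS]mule1; congr (_ * _); exact: l1.
  have lin (s t : R) : \int[l]_x (s * u x + t)%:E =
      (s * fine (\int[l]_x (u x)%:E) + t)%:E.
    under eq_integral do rewrite EFinD EFinM.
    rewrite integralD//; [|exact: integrableZl (iu l)|exact: ic].
    rewrite integralZl//; last exact: iu.
    by rewrite EFinD EFinM -aE; congr (_ + _); exact: cE.
  split.
  - by rewrite -aE; apply: eq_integral => x _; rewrite fK.
  - rewrite (_ : 1 - _ = -1 * fine (\int[l]_x (u x)%:E) + 1)%R; last ring.
    rewrite -lin; apply: eq_integral => x _.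
    by rewrite -fK// KC// /u; congr EFin; ring.
  - exact: (lin 2 (- c))%R.
have := integral_diff_tv m m' mu2 uc.
have [a [-> -> ->]] := Iu m m1; have [b [-> -> ->]] := Iu m' m'1.
apply: le_trans; rewrite -!EFinB !abse_EFin -EFinD lee_fin.
rewrite (_ : 1 - a - (1 - b) = - (a - b))%R; last ring.
rewrite (_ : 2 * a - c - (2 * b - c) = 2 * (a - b))%R; last ring.
by rewrite normrN normrM (@ger0_norm _ 2%R)//; lra.
Qed.

End dobrushin_contraction.

(** * The Bayesian update *)

Lemma measurable_inv (R : realType) : measurable_fun [set: R] (@GRing.inv R).
Proof.
rewrite (_ : @GRing.inv R = fun x => if x == 0%R then 0%R else x^-1%R); last first.
  by apply/funext => x; case: eqVneq => // ->; rewrite invr0.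
have m0 : measurable_fun [set: R] (fun x : R => x == 0%R).
  by apply: (measurable_fun_bool true); rewrite setTI (_ : _ @^-1` _ = [set 0%R])//;
    apply/seteqP; split => x /= /eqP.
apply: measurable_fun_if => //.
rewrite setTI; apply: open_continuous_measurable_fun.
  rewrite (_ : _ @^-1` _ = [set x : R | x != 0%R]); first exact: open_neq.
  by apply/seteqP; split => x /=; [move=> /negbT|move=> /negbTE].
by move=> x; rewrite inE/= => /negbT x0; exact: inv_continuous.
Qed.

(** A nonnegative function of zero integral vanishes almost everywhere, and
    null sets are inherited by dominated measures. *)
Lemma dominates_integral0 d (T : measurableType d) (R : realType)
    (m m' : {measure set T -> \bar R}) A (f : T -> \bar R) :
  m `<< m' -> measurable A -> measurable_fun A f -> (forall x, 0 <= f x) ->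
  \int[m']_(x in A) f x = 0 -> \int[m]_(x in A) f x = 0.
Proof.
move=> mm' mA mf f0 h0.
have : \int[m']_(x in A) `|f x| = 0.
  by rewrite -[RHS]h0; apply: eq_integral => x _; rewrite gee0_abs.
move/(ae_eq_integral_abs _ mA mf)/(null_dominates_ae_eq mA mm') => h.
by rewrite (ae_eq_integral (cst 0) f mA mf)//; exact: integral0.
Qed.

Lemma abse_subC (R : realDomainType) (x y : \bar R) : `|x - y| = `|y - x|.
Proof. by move: x y => [x| |] [y| |]//=; rewrite distrC. Qed.

Lemma integral_dist_le d (T : measurableType d) (R : realType)
    (m : {measure set T -> \bar R}) A (f g : T -> \bar R) :
  measurable A -> m.-integrable A f -> m.-integrable A g ->
  (forall x, A x -> g x <= f x) ->
  \int[m]_(x in A) `|f x - g x| <= `|\int[m]_(x in A) f x - \int[m]_(x in A) g x|.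
Proof.
move=> mA fi gi gf; rewrite -integralB//.
have iD := integrableB mA fi gi; have mD := measurable_int _ iD.
rewrite (ae_eq_integral (f \- g) _ mA)//.
- exact: lee_abs.
- exact: measurableT_comp.
- have := integrable_ae mA gi; apply: filterS => x gx Ax.
  by rewrite gee0_abs// sube_ge0 ?gf// gx ?orbT.
Qed.

Lemma nneg_add_lty (R : realDomainType) (u v : \bar R) :
  0 <= u -> 0 <= v -> u + v < +oo -> u < +oo /\ v < +oo.
Proof. by move: u v => [u| |] [v| |]//= _ _ _; rewrite !ltry. Qed.

Lemma nneg_add_real (R : realDomainType) (u v : \bar R) :
  0 <= u -> 0 <= v -> u + v < +oo ->
  exists r s : R, [/\ (0 <= r)%R, (0 <= s)%R, u = r%:E & v = s%:E].
Proof. by move: u v => [u| |] [v| |]//= u0 v0 _; exists u, v. Qed.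

(** With N = a + b and N' = a' + b', the product N (a / N - a' / N') is
    (a - a') - (a' / N') (N - N'), and likewise for b; the weights a' / N' and
    b' / N' add up to one. *)
Lemma ratio_bound (R : realFieldType) (a b a' b' : R) :
  (0 <= a' -> 0 <= b' -> 0 < a + b -> 0 < a' + b' ->
  (a + b) * (`|a / (a + b) - a' / (a' + b')| + `|b / (a + b) - b' / (a' + b')|) <=
  `|a - a'| + `|b - b'| + `|(a + b) - (a' + b')|)%R.
Proof.
move=> a'0 b'0; set N := (a + b)%R; set N' := (a' + b')%R => N0 N'0.
have h c c' : (0 <= c' -> N * `|c / N - c' / N'| <= `|c - c'| + c' / N' * `|N - N'|)%R.
  move=> c'0; rewrite -[X in (X * _)%R](gtr0_norm N0) -normrM.
  rewrite (_ : N * _ = (c - c') + c' / N' * (N' - N))%R; last first.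
    by field; rewrite !gt_eqF.
  rewrite (le_trans (ler_normD _ _))// lerD2l normrM distrC.
  by rewrite ger0_norm// divr_ge0// ltW.
rewrite mulrDr (le_trans (lerD (h _ _ a'0) (h _ _ b'0)))// addrACA lerD2l.
by rewrite -mulrDl -mulrDl mulfV ?mul1r// gt_eqF.
Qed.

Section bayes_update.
Context (R : realType) dx dy (X : measurableType dx) (Y : measurableType dy).
Variables (Q : R.-pker X ~> Y) (lam : probability Y R) (g : likelihood Q lam).

Let mg : measurable_fun [set: X * Y] (fun z => (g z)%:E).
Proof. by apply/measurable_EFinP; exact: likelihood_measurable. Qed.

Let g0 z : 0 <= (g z)%:E. Proof. by rewrite lee_fin likelihood_ge0. Qed.

Let mg1 y : measurable_fun [set: X] (fun x => (g (x, y))%:E).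
Proof. exact: measurableT_comp mg (pair2_measurable y). Qed.

Lemma likelihood_integral x (f : Y -> \bar R) :
  measurable_fun [set: Y] f -> (forall y, 0 <= f y) ->
  \int[Q x]_y f y = \int[lam]_y (f y * (g (x, y))%:E).
Proof.
move=> mf f0; apply: (@ge0_integral_density _ _ _ _ _ (fun y => g (x, y))) => //.
- exact: measurableT_comp (likelihood_measurable g) (pair1_measurable x).
- by move=> y; exact: likelihood_ge0.
- by move=> A mA; exact: likelihoodE.
Qed.

(** Tonelli: the normalizer is the density of the law of the observation. *)
Lemma integral_likelihood (m : {finite_measure set X -> \bar R}) B :
  measurable B ->
  \int[lam]_(y in B) \int[m]_x (g (x, y))%:E = \int[m]_x Q x B.
Proof.
move=> mB.
under [RHS]eq_integral do rewrite (likelihoodE g _ mB) integral_mkcond.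
rewrite [LHS]integral_mkcond.
pose h (z : X * Y) := (g z)%:E * (\1_B z.2)%:E.
have mh : measurable_fun [set: X * Y] h.
  apply: emeasurable_funM => //; apply/measurable_EFinP.
  exact: measurableT_comp.
have h0 z : 0 <= h z by rewrite mule_ge0// lee_fin.
transitivity (\int[lam]_y \int[m]_x h (x, y)).
  apply: eq_integral => y _; rewrite epatch_indic.
  rewrite -ge0_integralZr//; first by rewrite lee_fin.
rewrite -(fubini_tonelli _ mh h0).
by apply: eq_integral => x _; apply: eq_integral => y _; rewrite epatch_indic.
Qed.

Lemma measurable_normalizer (m : {finite_measure set X -> \bar R}) :
  measurable_fun [set: Y] (fun y => \int[m]_x (g (x, y))%:E).
Proof. exact: (@measurable_fun_fubini_tonelli_G _ _ X Y R m (EFin \o g) mg g0). Qed.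

Lemma integrable_normalizer (m : {finite_measure set X -> \bar R}) :
  lam.-integrable [set: Y] (fun y => \int[m]_x (g (x, y))%:E).
Proof.
apply/integrableP; split; first exact: measurable_normalizer.
under eq_integral do rewrite gee0_abs ?integral_ge0//.
rewrite integral_likelihood//.
under eq_integral do rewrite prob_kernel.
by rewrite integral_cst// mul1e ltey_eq fin_num_measure.
Qed.

(** Both degenerate cases agree with the convention that the inverse of 0 is
    0: an infinite normalizer has fine part 0, and a zero normalizer makes the
    integral vanish. *)
Lemma bayesE (m : subprobability X R) y A : measurable A ->
  bayes g m y A = \int[m]_(x in A) (g (x, y))%:E * ((fine (normalizer g m y))^-1)%:E.
Proof.
move=> mA; rewrite /bayes /bayes_density; have [N0|] := boolP (0 < _).
  under eq_integral do rewrite EFinM.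
  rewrite ge0_integralZr//; first exact: measurable_funTS.
  by rewrite lee_fin invr_ge0 fine_ge0// ltW.
rewrite -leNgt => N0; rewrite integral0_eq//.
have -> : normalizer g m y = 0 by apply/eqP; rewrite eq_le N0 integral_ge0.
by rewrite invr0 mule0.
Qed.

Lemma bayes_setT (m : subprobability X R) y :
  0 < normalizer g m y < +oo -> bayes g m y setT = 1.
Proof.
move=> Ny; rewrite bayesE//; case/andP: Ny => N0 Noo.
have Nf : normalizer g m y \is a fin_num by rewrite ge0_fin_numE// ltW.
rewrite -/(normalizer g m y) -[X in X * _]fineK// -EFinM mulfV//.
by rewrite gt_eqF// fine_gt0// N0.
Qed.

Lemma normalizer_dominates (m m' : subprobability X R) y :
  m `<< m' -> normalizer g m' y = 0 -> normalizer g m y = 0.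
Proof.
by move=> mm'; apply: dominates_integral0 => // x.
Qed.

Lemma bayes_dominates (m m' : subprobability X R) y :
  m `<< m' -> normalizer g m' y < +oo ->
  bayes g m y `<< bayes g m' y.
Proof.
move=> mm' N'oo; apply/null_content_dominatesP => A mA.
move=> /(etrans (esym (bayesE m' y mA)))/eqP; rewrite mule_eq0.
rewrite (bayesE m y mA) => /orP[/eqP h|].
  rewrite (dominates_integral0 mm' mA _ _ h) ?mul0e//.
  exact: measurable_funTS.
rewrite eqe invr_eq0 fine_eq0; last first.
  by rewrite ge0_fin_numE// integral_ge0.
move=> /eqP /(normalizer_dominates mm') ->; by rewrite invr0 mule0.
Qed.

(** Writing N and N' for the normalizers, N times the difference of the updates
    is g (m - m') + (1 - N / N') g m'. The first term is at most
    g p + g q, and the second has total mass |N - N'|. *)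
Lemma bayes_tv_le (m m' : subprobability X R)
    (p q : {finite_measure set X -> \bar R}) y :
  (forall A, measurable A -> m A + q A = m' A + p A) ->
  normalizer g m y < +oo -> normalizer g m' y < +oo ->
  (normalizer g m' y = 0 -> normalizer g m y = 0) ->
  normalizer g m y * tv_norm (bayes g m y) (bayes g m' y) <=
  \int[p]_x (g (x, y))%:E + \int[q]_x (g (x, y))%:E +
  `|normalizer g m y - normalizer g m' y|.
Proof.
move=> mqE Noo N'oo N'N.
have I0 (l : {measure set X -> \bar R}) A : 0 <= \int[l]_(x in A) (g (x, y))%:E.
  exact: integral_ge0.
have [->|N_neq0] := eqVneq (normalizer g m y) 0.
  by rewrite mul0e adde_ge0// adde_ge0//; exact: I0.
(* Nothing in the hypotheses makes these two integrals finite. *)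
have [poo|pfin] := eqVneq (\int[p]_x (g (x, y))%:E + \int[q]_x (g (x, y))%:E) +oo.
  by rewrite poo addye ?leey// gt_eqF//; exact: lt_le_trans (ltNyr 0%R) (abse_ge0 _).
have [S mS ->] := tv_norm_attained (bayes g m y) (bayes g m' y).
have mCS := measurableC mS.
have -> : set_dist (bayes g m y) (bayes g m' y) S =
    `|\int[m]_(x in S) (g (x, y))%:E * ((fine (normalizer g m y))^-1)%:E -
      \int[m']_(x in S) (g (x, y))%:E * ((fine (normalizer g m' y))^-1)%:E| +
    `|\int[m]_(x in ~` S) (g (x, y))%:E * ((fine (normalizer g m y))^-1)%:E -
      \int[m']_(x in ~` S) (g (x, y))%:E * ((fine (normalizer g m' y))^-1)%:E|.
  by rewrite -!bayesE.
have sp (l : {measure set X -> \bar R}) : \int[l]_x (g (x, y))%:E =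
    \int[l]_(x in S) (g (x, y))%:E + \int[l]_(x in ~` S) (g (x, y))%:E.
  rewrite -ge0_integral_setU ?setUv//.
  by rewrite disj_set2E setICr.
have rel A : measurable A ->
    \int[m]_(x in A) (g (x, y))%:E + \int[q]_(x in A) (g (x, y))%:E =
    \int[m']_(x in A) (g (x, y))%:E + \int[p]_(x in A) (g (x, y))%:E.
  move=> mA; rewrite -!ge0_integral_measure_add//; try exact: measurable_funTS.
  exact: eq_measure_integral_add.
move: (rel _ mS) (rel _ mCS) N_neq0 Noo N'oo N'N pfin.
rewrite /normalizer !sp => rS rC Nneq0 Noo N'oo N'N pq_neqoo.
have pq_oo : \int[p]_(x in S) (g (x, y))%:E + \int[p]_(x in ~` S) (g (x, y))%:E +
    (\int[q]_(x in S) (g (x, y))%:E + \int[q]_(x in ~` S) (g (x, y))%:E) < +oo.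
  by rewrite ltey.
have [p_oo q_oo] := nneg_add_lty (adde_ge0 (I0 p S) (I0 p (~` S)))
  (adde_ge0 (I0 q S) (I0 q (~` S))) pq_oo.
have [a [b [a0 b0 aE bE]]] := nneg_add_real (I0 m S) (I0 m (~` S)) Noo.
have [a' [b' [a'0 b'0 a'E b'E]]] := nneg_add_real (I0 m' S) (I0 m' (~` S)) N'oo.
have [c [e [c0 e0 cE eE]]] := nneg_add_real (I0 p S) (I0 p (~` S)) p_oo.
have [c' [e' [c'0 e'0 c'E e'E]]] := nneg_add_real (I0 q S) (I0 q (~` S)) q_oo.
move: rS rC Nneq0 N'N.
rewrite aE bE a'E b'E cE eE c'E e'E -!EFinD => -[rS] [rC] /=.
rewrite !eqe => N_neq0 N'N.
rewrite lee_fin.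
have N0 : (0 < a + b)%R by rewrite lt0r N_neq0 addr_ge0.
have N'0 : (0 < a' + b')%R.
  rewrite lt0r addr_ge0// andbT; apply: contra N_neq0 => /eqP h.
  by apply/eqP/EFin_inj/N'N; rewrite h.
apply: (le_trans (ratio_bound a'0 b'0 N0 N'0)).
rewrite lerD2r.
have : (`|a - a'| <= c + c')%R by rewrite ler_norml; apply/andP; split; lra.
have : (`|b - b'| <= e + e')%R by rewrite ler_norml; apply/andP; split; lra.
lra.
Qed.

Lemma measurable_normalizer2 :
  measurable_fun [set: giry X R * Y] (fun z => normalizer g z.1 z.2).
Proof.
pose h (z : (giry X R * Y) * X) := (g (z.2, z.1.2))%:E.
apply: (@measurable_integral_param _ _ _ _ _ fst measurable_fst h) => [|z].
- apply: (measurableT_comp mg).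
  apply/measurable_fun_pair; first exact: measurable_snd.
  exact: (measurableT_comp measurable_snd measurable_fst).
- exact: g0.
Qed.

Lemma measurable_bayes :
  measurable_fun [set: giry X R * Y] (fun z => bayes g z.1 z.2 : giry X R).
Proof.
apply: measurable_giry_codensity => // A mA.
pose h (z : (giry X R * Y) * X) := (g (z.2, z.1.2))%:E * (\1_A z.2)%:E.
rewrite (_ : (fun z => _) = fun z : giry X R * Y =>
    (\int[z.1]_x h (z, x)) * ((fine (normalizer g z.1 z.2))^-1)%:E); last first.
  apply/funext => z; apply: (etrans (bayesE z.1 z.2 mA)); congr (_ * _).
  by rewrite integral_mkcond; apply: eq_integral => x _; rewrite epatch_indic.
apply: emeasurable_funM.
- apply: (@measurable_integral_param _ _ _ _ _ fst measurable_fst h) => [|z].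
  + apply: emeasurable_funM.
      apply: (measurableT_comp mg).
      apply/measurable_fun_pair; first exact: measurable_snd.
      exact: (measurableT_comp measurable_snd measurable_fst).
    apply/measurable_EFinP.
    exact: (measurableT_comp (measurable_indic mA) measurable_snd).
  + by rewrite mule_ge0// lee_fin.
- apply/measurable_EFinP; apply: (measurableT_comp (@measurable_inv R)).
  exact: (measurableT_comp (fine_measurable measurableT) measurable_normalizer2).
Qed.

Lemma measurable_bayes_comp d (S : measurableType d) (k : S -> giry X R)
    (v : S -> Y) :
  measurable_fun [set: S] k -> measurable_fun [set: S] v ->
  measurable_fun [set: S] (fun s => bayes g (k s) (v s) : giry X R).
Proof.
by move=> mk mv; exact: (measurableT_comp measurable_bayes (measurable_fun_pair mk mv)).
Qed.

(** The left-hand side is the total variation distance of the two laws of the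
    observation, which is reached on the set where the first density dominates
    the second. These laws are the images of m and m' under Q. *)
Lemma normalizer_diff_le (m m' : subprobability X R) :
  m setT = 1 -> m' setT = 1 ->
  \int[lam]_y `|normalizer g m y - normalizer g m' y| <=
  (1 - dobrushin Q)%:E * tv_norm m m'.
Proof.
move=> m1 m'1.
have iN := integrable_normalizer m; have iN' := integrable_normalizer m'.
have mN := measurable_normalizer m; have mN' := measurable_normalizer m'.
have mD : measurable_fun [set: Y] (fun y => `|normalizer g m y - normalizer g m' y|).
  by apply: measurableT_comp => //; exact: emeasurable_funB.
pose S := [set y | normalizer g m' y <= normalizer g m y].
have mS : measurable S by rewrite -[S]setTI; exact: measurable_lee.
have mCS := measurableC mS.
rewrite -(setUv S) ge0_integral_setU//; last 2 first.
- by rewrite setUv.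
- by rewrite disj_set2E setICr.
apply: le_trans (dobrushin_contraction Q m1 m'1 mS).
rewrite -!integral_likelihood//; apply: leeD.
  apply: integral_dist_le => //; first exact: integrableS iN.
  exact: integrableS iN'.
rewrite abse_subC; under eq_integral do rewrite abse_subC.
apply: integral_dist_le => //; first exact: integrableS iN'.
  exact: integrableS iN.
by move=> y /negP; rewrite -ltNge => /ltW.
Qed.

Lemma integral_normalizer (m : {finite_measure set X -> \bar R}) :
  \int[lam]_y \int[m]_x (g (x, y))%:E = m setT.
Proof.
rewrite integral_likelihood//; under eq_integral do rewrite prob_kernel.
by rewrite integral_cst// mul1e.
Qed.

Hypothesis mtv :
  measurable_fun [set: giry X R * giry X R] (fun x => tv_norm x.1 x.2).

Lemma measurable_tv_comp d (S : measurableType d) (k l : S -> giry X R) :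
  measurable_fun [set: S] k -> measurable_fun [set: S] l ->
  measurable_fun [set: S] (fun s => tv_norm (k s) (l s)).
Proof.
by move=> mk ml; exact: (measurableT_comp mtv (measurable_fun_pair mk ml)).
Qed.

(** Integrate bayes_tv_le in y: the first two terms give the total masses of p
    and q, which add up to tv_norm m m', and the last one is bounded by
    normalizer_diff_le. *)
Lemma bayes_contraction (m m' : subprobability X R) :
  m setT = 1 -> m' setT = 1 -> m `<< m' ->
  \int[lam]_y (normalizer g m y * tv_norm (bayes g m y) (bayes g m' y)) <=
  (2 - dobrushin Q)%:E * tv_norm m m'.
Proof.
move=> m1 m'1 mm'; have [p [q [mqE pqE]]] := tv_normP m m'.
have iN := integrable_normalizer m; have iN' := integrable_normalizer m'.
have mN := measurable_normalizer m; have mN' := measurable_normalizer m'.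
have mp := measurable_normalizer p; have mq := measurable_normalizer q.
have I0 (l : {measure set X -> \bar R}) y : 0 <= \int[l]_x (g (x, y))%:E.
  exact: integral_ge0.
have mD : measurable_fun [set: Y] (fun y => `|normalizer g m y - normalizer g m' y|).
  by apply: measurableT_comp => //; exact: emeasurable_funB.
apply: (@le_trans _ _ (\int[lam]_y (\int[p]_x (g (x, y))%:E +
    \int[q]_x (g (x, y))%:E + `|normalizer g m y - normalizer g m' y|))).
  apply: ae_ge0_le_integral => //.
  - by move=> y _; rewrite mule_ge0//; [exact: I0|exact: tv_norm_ge0].
  - apply: emeasurable_funM => //.
    apply: (@measurable_tv_comp _ _ (fun y => bayes g m y : giry X R)
      (fun y => bayes g m' y : giry X R)); exact: measurable_bayes_comp.
  - by move=> y _; rewrite adde_ge0// adde_ge0//; exact: I0.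
  - by apply: emeasurable_funD => //; exact: emeasurable_funD.
  - have := integrable_ae measurableT iN; have := integrable_ae measurableT iN'.
    apply: filterS2 => y /(_ Logic.I) h' /(_ Logic.I) h _.
    apply: bayes_tv_le => //; [by rewrite ltey_eq h|by rewrite ltey_eq h'|].
    exact: normalizer_dominates.
rewrite ge0_integralD//; last 2 first.
- by move=> y _; rewrite adde_ge0//; exact: I0.
- exact: emeasurable_funD.
rewrite ge0_integralD//.
rewrite !integral_normalizer pqE.
rewrite (_ : 2 - dobrushin Q = 1 + (1 - dobrushin Q))%R; last ring.
rewrite EFinD ge0_muleDl//; last by rewrite lee_fin subr_ge0 dobrushin_le1.
by rewrite mul1e leeD2l// normalizer_diff_le.
Qed.

End bayes_update.

(** * Prediction and observation *)

Section joint_kernel.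
Context (R : realType) dx dy (X : measurableType dx) (Y : measurableType dy).
Variable Q : R.-pker X ~> Y.

(** The joint law of a state distributed as m and of its observation. *)
Definition joint_kernel (m : giry X R) : giry (X * Y)%type R :=
  giry_bind m (measurable_giry_pair (measurable_giry_of_kernel Q)).

Lemma measurable_joint_kernel : measurable_fun [set: giry X R] joint_kernel.
Proof. exact: measurable_giry_bind. Qed.

Lemma joint_kernelE (m : giry X R) A : measurable A ->
  joint_kernel m A = \int[m]_x Q x (xsection A x).
Proof.
move=> mA.
apply: (etrans (giry_bindE m (measurable_giry_pair (measurable_giry_of_kernel Q)) mA)).
apply: eq_integral => x _.
transitivity (giry_int (giry_prod (giry_ret x, giry_of_kernel Q x)) (EFin \o \1_A)).
  by rewrite /giry_int/= integral_indic// setIT.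
rewrite giry_int_pair; last 2 first.
- exact/measurable_EFinP/measurable_indic.
- by move=> z; rewrite lee_fin.
transitivity (\int[Q x]_y (\1_(xsection A x) y)%:E).
  by apply: eq_integral => y _; rewrite /= !indicE mem_xsection.
by rewrite integral_indic ?setIT//; exact: measurable_xsection.
Qed.

Lemma joint_kernel_integral (m : giry X R) (h : X * Y -> \bar R) :
  measurable_fun [set: X * Y] h -> (forall z, 0 <= h z) ->
  \int[joint_kernel m]_z h z = \int[m]_x \int[Q x]_y h (x, y).
Proof.
move=> mh h0; rewrite -/(giry_int (joint_kernel m) h) giry_int_bind//.
by apply: eq_integral => x _; rewrite giry_int_pair.
Qed.

End joint_kernel.

Section prediction.
Context (R : realType) dx (X : measurableType dx) (T : R.-pker X ~> X).

Lemma measurable_predict :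
  measurable_fun [set: giry X R] (fun m => predict T m : giry X R).
Proof.
apply: measurable_giry_codensity => // A mA.
by apply: measurable_giry_int => //; exact: measurable_kernel.
Qed.

Lemma predict_integral (m : subprobability X R) (f : X -> \bar R) :
  measurable_fun [set: X] f -> (forall x, 0 <= f x) ->
  \int[predict T m]_x f x = \int[m]_x \int[T x]_z f z.
Proof.
move=> mf f0.
pose b := giry_bind (m : giry X R) (measurable_giry_of_kernel T).
transitivity (giry_int b f); last by rewrite giry_int_bind.
apply: eq_measure_integral => A mA _.
by rewrite -[RHS]/(b A) giry_bindE.
Qed.

Lemma predict_setT (m : subprobability X R) : predict T m setT = m setT.
Proof.
rewrite /predict; under eq_integral do rewrite prob_kernel.
by rewrite integral_cst// mul1e.
Qed.

Lemma predict_dominates (m m' : subprobability X R) :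
  m `<< m' -> predict T m `<< predict T m'.
Proof.
move=> mm'; apply/null_content_dominatesP => A mA.
apply: dominates_integral0 => //; exact: measurable_kernel.
Qed.

Lemma predict_tv (m m' : subprobability X R) :
  m setT = 1 -> m' setT = 1 ->
  tv_norm (predict T m) (predict T m') <= (1 - dobrushin T)%:E * tv_norm m m'.
Proof.
by move=> m1 m'1; apply: tv_norm_le => A mA; exact: dobrushin_contraction.
Qed.

End prediction.

Section generated.
Context d (Om : measurableType d) dY (Y : measurableType dY).
Variables (G : set (set Om)) (V : Om -> Y).

(** Generators of the sigma-algebra obtained by also observing V. *)
Definition with_events := G `|` preimage_set_system [set: Om] V measurable.

Local Notation Og := (g_sigma_algebraType G).
Local Notation Og' := (g_sigma_algebraType with_events).

Lemma measurable_with_events_id : measurable_fun [set: Og'] (id : Og' -> Og).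
Proof.
move=> _ B mB; rewrite setTI preimage_id.
move: B mB; apply: smallest_sub; first exact: smallest_sigma_algebra.
by move=> B GB; apply: sub_sigma_algebra; left.
Qed.

Lemma measurable_with_events_obs : measurable_fun [set: Og'] (V : Og' -> Y).
Proof.
move=> _ B mB; rewrite setTI; apply: sub_sigma_algebra; right.
by exists B => //; rewrite setTI.
Qed.

(** Such an event is a measurable condition on the old information together
    with the new observation, which is what the disintegration formula sees. *)
Lemma with_events_preimage B : <<s with_events >> B ->
  exists2 D : set (Og * Y), measurable D & B = [set w | D (w, V w)].
Proof.
move: B; apply: smallest_sub.
  split.
  - by exists set0.
  - move=> _ [D mD ->]; exists (~` D); first exact: measurableC.
    by rewrite setTD.
  - move=> F hF; have [D DP] := choice (fun n => (exists2P _ _).1 (hF n)).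
    exists (\bigcup_n D n).
      by apply: bigcup_measurable => n _; case: (DP n).
    apply/seteqP; split => w [n _].
      by case: (DP n) => mD -> Dw; exists n.
    by case: (DP n) => mD FE Dw; exists n => //; rewrite FE.
move=> B [GB|[C mC <-]].
- exists (B `*` setT); first by apply: measurableX => //; exact: sub_sigma_algebra.
  by apply/seteqP; split => w // [].
- exists (setT `*` C); first exact: measurableX.
  by rewrite setTI; apply/seteqP; split => w // [].
Qed.

End generated.

(** * Updating a conditional law with one more observation *)

(** What a true filter and a wrongly initialized one must satisfy for one more
    step to be contracting; the point is that it is preserved along the
    recursion outside a null event. *)
Definition comparable_probabilities d (T : measurableType d) (R : realType)
    (m m' : subprobability T R) := [/\ m setT = 1, m' setT = 1 & m `<< m'].

Section observation_step.
Context (R : realType) dx dy (X : measurableType dx) (Y : measurableType dy).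
Variables (Q : R.-pker X ~> Y) (lam : probability Y R) (g : likelihood Q lam).
Context d (Om : measurableType d).
Variables (P : probability Om R) (G : set (set Om)).
Hypothesis mG : G `<=` measurable.
Local Notation Og := (g_sigma_algebraType G).
Variables (X' : Om -> X) (Y' : Om -> Y) (k : Om -> giry X R).
Hypotheses (mX' : measurable_fun [set: Om] X') (mY' : measurable_fun [set: Om] Y').
Hypothesis mk : measurable_fun [set: Og] (k : Og -> giry X R).
Hypothesis kP :
  is_cond_law P G (fun w => (X' w, Y' w)) (fun w => joint_kernel Q (k w)).

Let mg : measurable_fun [set: X * Y] (fun z => (g z)%:E).
Proof. by apply/measurable_EFinP; exact: likelihood_measurable. Qed.

Let g0 z : 0 <= (g z)%:E. Proof. by rewrite lee_fin likelihood_ge0. Qed.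

Lemma measurable_coarse dZ (Z : measurableType dZ) (f : Om -> Z) :
  measurable_fun [set: Og] (f : Og -> Z) -> measurable_fun [set: Om] f.
Proof. by move=> mf; exact: (measurableT_comp mf (measurable_id_coarse mG)). Qed.

(** If k is the prediction of the next state, the next state and its observation
    have, given the past, the joint density g with respect to the product of
    k and lam. *)
Lemma joint_integral (h : Og * (X * Y) -> \bar R) :
  measurable_fun [set: Og * (X * Y)] h -> (forall z, 0 <= h z) ->
  \int[P]_w h (w, (X' w, Y' w)) =
  \int[P]_w \int[lam]_y \int[k w]_x (h (w, (x, y)) * (g (x, y))%:E).
Proof.
move=> mh h0.
have mXY : measurable_fun [set: Om] (fun w => (X' w, Y' w)).
  exact/measurable_fun_pair.
rewrite (cond_law_integral mG mXY kP mh h0).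
apply: eq_integral => w _.
have mhw : measurable_fun [set: X * Y] (fun z => h (w, z)).
  exact: measurableT_comp mh (pair1_measurable (w : Og)).
rewrite joint_kernel_integral//.
transitivity (\int[k w]_x \int[lam]_y (h (w, (x, y)) * (g (x, y))%:E)).
  apply: eq_integral => x _; rewrite (likelihood_integral g)//.
  exact: measurableT_comp mhw (pair1_measurable x).
apply: (@fubini_tonelli _ _ _ _ _ (k w) lam
  (fun z => h (w, z) * (g z)%:E)).
- exact: emeasurable_funM.
- by move=> z; rewrite mule_ge0.
Qed.

(** Given the past, the next observation has density the normalizer of the
    prediction with respect to lam. *)
Lemma observation_integral (h : Og * Y -> \bar R) :
  measurable_fun [set: Og * Y] h -> (forall z, 0 <= h z) ->
  \int[P]_w h (w, Y' w) = \int[P]_w \int[lam]_y (h (w, y) * normalizer g (k w) y).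
Proof.
move=> mh h0.
pose h' (z : Og * (X * Y)) := h (z.1, z.2.2).
have mh' : measurable_fun [set: Og * (X * Y)] h'.
  apply: (measurableT_comp mh); apply/measurable_fun_pair; first exact: measurable_fst.
  exact: measurableT_comp measurable_snd measurable_snd.
rewrite (joint_integral mh' (fun z => h0 (z.1, z.2.2))).
apply: eq_integral => w _; apply: eq_integral => y _.
rewrite /h'/= ge0_integralZl//.
exact: measurableT_comp mg (pair2_measurable y).
Qed.

Lemma normalizer_ae (m : subprobability X R) :
  {ae lam, forall y, normalizer g m y < +oo}.
Proof.
have := integrable_ae measurableT (integrable_normalizer g m).
by apply: filterS => y /(_ Logic.I) h; rewrite ltey_eq h.
Qed.

(** The recursion computes the filter. On the event with D in the past and the
    new observation, both sides integrate the same thing: multiplying the update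
    by the density of the observation cancels the normalizer. *)
Lemma bayes_cond_law :
  is_cond_law P (with_events G Y') X' (fun w => bayes g (k w) (Y' w) : giry X R).
Proof.
have mb : measurable_fun [set: g_sigma_algebraType (with_events G Y')]
    (fun w => bayes g (k w) (Y' w) : giry X R).
  apply: measurable_bayes_comp.
    exact: (measurableT_comp mk (@measurable_with_events_id _ Om _ Y G Y')).
  exact: measurable_with_events_obs.
move=> A mA; split; first exact: (measurableT_comp (measurable_giry_ev mA) mb).
move=> B /with_events_preimage[D mD ->].
pose hA (z : Og * (X * Y)) := (\1_A z.2.1 * \1_D (z.1, z.2.2))%:E : \bar R.
have mhA : measurable_fun [set: Og * (X * Y)] hA.
  apply/measurable_EFinP; apply: measurable_funM.
    apply: (measurableT_comp (measurable_indic mA)).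
    exact: measurableT_comp measurable_fst measurable_snd.
  apply: (measurableT_comp (measurable_indic mD)).
  apply/measurable_fun_pair; first exact: measurable_fst.
  exact: measurableT_comp measurable_snd measurable_snd.
have hA0 z : 0 <= hA z by rewrite lee_fin mulr_ge0.
pose hD (z : Og * Y) := (\1_D z)%:E * bayes g (k z.1) z.2 A.
have mhD : measurable_fun [set: Og * Y] hD.
  apply: emeasurable_funM; first exact/measurable_EFinP/measurable_indic.
  apply: (measurableT_comp (measurable_giry_ev mA)).
  apply: measurable_bayes_comp; last exact: measurable_snd.
  exact: measurableT_comp mk measurable_fst.
have hD0 z : 0 <= hD z by rewrite mule_ge0// lee_fin.
have mDw : measurable [set w | D (w, Y' w)].
  rewrite -[X in measurable X]setTI.
  have mp : measurable_fun [set: Om] (fun w => ((w : Og), Y' w)).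
    by apply/measurable_fun_pair => //; exact: measurable_id_coarse.
  exact: mp.
transitivity (\int[P]_w hD (w, Y' w)).
  rewrite integral_mkcond; apply: eq_integral => w _.
  by rewrite epatch_indic /hD muleC.
transitivity (\int[P]_w hA (w, (X' w, Y' w))); last first.
  have mS : measurable (X' @^-1` A `&` [set w | D (w, Y' w)]).
    by apply: measurableI => //; rewrite -[X in measurable X]setTI; exact: mX'.
  rewrite -(setIT (X' @^-1` A `&` _)) -integral_indic//.
  by apply: eq_integral => w _; rewrite /hA indicI.
rewrite (observation_integral mhD hD0) (joint_integral mhA hA0).
apply: eq_integral => w _.
pose J y := \int[k w]_x ((g (x, y))%:E * (\1_A x)%:E).
have JE y : J y = \int[k w]_(x in A) (g (x, y))%:E.
  by rewrite integral_mkcond; apply: eq_integral => x _; rewrite epatch_indic.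
have mgA : measurable_fun [set: X * Y] (fun z => (g z)%:E * (\1_A z.1)%:E).
  apply: emeasurable_funM => //; apply/measurable_EFinP.
  exact: (measurableT_comp (measurable_indic mA) measurable_fst).
have mJ : measurable_fun [set: Y] J.
  apply: (@measurable_fun_fubini_tonelli_G _ _ X Y R (k w) _ mgA) => z.
  by rewrite mule_ge0// lee_fin.
have mDw' : measurable_fun [set: Y] (fun y => (\1_D ((w : Og), y))%:E : \bar R).
  apply/measurable_EFinP.
  exact: (measurableT_comp (measurable_indic mD) (pair1_measurable (w : Og))).
transitivity (\int[lam]_y ((\1_D ((w : Og), y))%:E * J y)); last first.
  apply: eq_integral => y _; rewrite /J -ge0_integralZl//.
  - by apply: eq_integral => x _; rewrite /hA/= -!EFinM; congr EFin; ring.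
  - exact: measurableT_comp mgA (pair2_measurable y).
  - by move=> x _; rewrite mule_ge0// lee_fin.
apply: ae_eq_integral => //.
- apply: emeasurable_funM; last exact: measurable_normalizer.
  exact: measurableT_comp mhD (pair1_measurable (w : Og)).
- exact: emeasurable_funM.
- have := normalizer_ae (k w); apply: filterS => y Ny _.
  rewrite /hD/= -muleA; congr (_ * _).
  apply: (etrans (f_equal (fun z => z * normalizer g (k w) y)
    (bayesE g (k w) y mA))).
  rewrite -JE.
  have N0 : 0 <= normalizer g (k w) y by exact: integral_ge0.
  have [N_eq0|N_neq0] := eqVneq (normalizer g (k w) y) 0.
    rewrite N_eq0 mule0; apply/esym/eqP; rewrite eq_le integral_ge0 ?andbT//; last first.
      by move=> x _; rewrite mule_ge0// lee_fin.
    rewrite -N_eq0; apply: ge0_le_integral => //.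
    - by move=> x _; rewrite mule_ge0// lee_fin.
    - exact: measurableT_comp mgA (pair2_measurable y).
    - exact: measurableT_comp mg (pair2_measurable y).
    - move=> x _; rewrite indicE; case: (x \in A); first by rewrite mule1.
      by rewrite mule0.
  have Nf : normalizer g (k w) y \is a fin_num by rewrite ge0_fin_numE.
  rewrite -muleA -[X in _ * (_ * X)]fineK// -EFinM mulVf ?mule1//.
  by rewrite fine_eq0.
Qed.

Variable l : Om -> giry X R.
Hypothesis ml : measurable_fun [set: Og] (l : Og -> giry X R).
Hypothesis kl : {ae P, forall w, comparable_probabilities (k w) (l w)}.
Hypothesis mtv :
  measurable_fun [set: giry X R * giry X R] (fun x => tv_norm x.1 x.2).

Let measurable_normalizer_param (f : Om -> giry X R) :
  measurable_fun [set: Og] (f : Og -> giry X R) ->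
  measurable_fun [set: Og * Y] (fun z => normalizer g (f z.1) z.2).
Proof.
move=> mf; apply: (measurableT_comp (measurable_normalizer2 g)
  (measurable_fun_pair (measurableT_comp mf measurable_fst) measurable_snd)).
Qed.

Let measurable_density_integral (h : Og * Y -> \bar R) :
  measurable_fun [set: Og * Y] h -> (forall z, 0 <= h z) ->
  (forall w : Og, measurable_fun [set: Y] (fun y => h (w, y) * normalizer g (k w) y)) /\
  measurable_fun [set: Om]
    (fun w => \int[lam]_y (h ((w : Og), y) * normalizer g (k w) y)).
Proof.
move=> mh h0; pose f (z : Og * Y) := h z * normalizer g (k z.1) z.2.
have mf : measurable_fun [set: Og * Y] f.
  by apply: emeasurable_funM => //; exact: measurable_normalizer_param.
have f0 z : 0 <= f z by rewrite mule_ge0//; exact: integral_ge0.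
split=> [w|]; first exact: measurableT_comp mf (pair1_measurable w).
by apply: measurable_coarse; exact: (@measurable_fun_fubini_tonelli_F _ _ _ _ _ lam f).
Qed.

(** The update fails to be a probability only if a normalizer is 0 or infinite.
    The observation has density the normalizer of the true prediction, so this
    one is almost surely neither; the other one is finite for almost every
    observation, and it vanishes only where the true one does. *)
Lemma comparable_bayes :
  {ae P, forall w, comparable_probabilities
    (bayes g (k w) (Y' w)) (bayes g (l w) (Y' w))}.
Proof.
(* Here z is a pair made of the past and of the new observation. *)
pose good := [set z : Og * Y | [&& 0 < normalizer g (k z.1) z.2 < +oo &
                                    0 < normalizer g (l z.1) z.2 < +oo]].
have mgood : measurable good.
  have mi (f : Om -> giry X R) : measurable_fun [set: Og] (f : Og -> giry X R) ->
      measurable [set z : Og * Y | 0 < normalizer g (f z.1) z.2 < +oo].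
    move=> mf; have mN := measurable_normalizer_param mf.
    rewrite [X in measurable X](_ : _ =
      [set z : Og * Y | 0 < normalizer g (f z.1) z.2] `&`
      [set z : Og * Y | normalizer g (f z.1) z.2 < +oo]); last first.
      by apply/seteqP; split => z /=; [move/andP|move=> ?; exact/andP].
    apply: measurableI; rewrite -[X in measurable X]setTI; exact: measurable_lte.
  rewrite [X in measurable X](_ : _ =
      [set z : Og * Y | 0 < normalizer g (k z.1) z.2 < +oo] `&`
      [set z : Og * Y | 0 < normalizer g (l z.1) z.2 < +oo]); last first.
    by apply/seteqP; split => z; [move/andP|move=> ?; exact/andP].
  by apply: measurableI; exact: mi.
have mbad := measurableC mgood.
have mp : measurable_fun [set: Om] (fun w => ((w : Og), Y' w)).
  by apply/measurable_fun_pair => //; exact: measurable_id_coarse.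
pose bad : set Om := (fun w => ((w : Og), Y' w)) @^-1` (~` good).
have mbadw : measurable bad.
  by rewrite -[X in measurable X]setTI; exact: (mp measurableT _ mbad).
have bad0 : P bad = 0.
  rewrite -(setIT bad) -integral_indic//.
  pose h (z : Og * Y) := (\1_(~` good) z)%:E : \bar R.
  have mh : measurable_fun [set: Og * Y] h.
    exact/measurable_EFinP/measurable_indic.
  have h0 z : 0 <= h z by rewrite lee_fin.
  have [mhN mhI] := measurable_density_integral mh h0.
  transitivity (\int[P]_w h ((w : Og), Y' w)) => //.
  rewrite (observation_integral mh h0).
  rewrite (ae_eq_integral (cst 0))//; first exact: integral0.
  apply: filterS kl => w [k1 l1 kl_w] _.
  rewrite (ae_eq_integral (cst 0))//; first exact: integral0.
  have := normalizer_ae (k w); have := normalizer_ae (l w).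
  apply: filterS2 => y Noo' Noo _; rewrite /h indicE.
  have [|] := boolP ((w, y) \in ~` good); last by rewrite mul0e.
  rewrite inE /good/= => /negP; rewrite Noo Noo' !andbT => b.
  have N0 : 0 <= normalizer g (k w) y by exact: integral_ge0.
  have N'0 : 0 <= normalizer g (l w) y by exact: integral_ge0.
  have [->|N_neq0] := eqVneq (normalizer g (k w) y) 0; first by rewrite mule0.
  exfalso; move: b; rewrite !lt0e N_neq0 N0 N'0/= andbT.
  by case: eqVneq => // /(normalizer_dominates kl_w) /eqP; rewrite (negbTE N_neq0).
have : {ae P, forall w, good ((w : Og), Y' w)}.
  by exists bad; split.
move: kl; apply: filterS2 => w [k1 l1 kl_w] /andP[Nk Nl]; split.
- exact: bayes_setT.
- exact: bayes_setT.
- by apply: bayes_dominates => //; case/andP: Nl.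
Qed.

(** Conditionally on the past, this is bayes_contraction. *)
Lemma bayes_error :
  \int[P]_w tv_norm (bayes g (k w) (Y' w)) (bayes g (l w) (Y' w)) <=
  (2 - dobrushin Q)%:E * \int[P]_w tv_norm (k w) (l w).
Proof.
pose h (z : Og * Y) := tv_norm (bayes g (k z.1) z.2) (bayes g (l z.1) z.2).
have mh : measurable_fun [set: Og * Y] h.
  apply: (measurable_tv_comp mtv (k := fun z : Og * Y => bayes g (k z.1) z.2 : giry X R)
    (l := fun z : Og * Y => bayes g (l z.1) z.2 : giry X R)).
    apply: measurable_bayes_comp; last exact: measurable_snd.
    exact: measurableT_comp mk measurable_fst.
  apply: measurable_bayes_comp; last exact: measurable_snd.
  exact: measurableT_comp ml measurable_fst.
have h0 z : 0 <= h z by exact: tv_norm_ge0.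
have [_ mhI] := measurable_density_integral mh h0.
have mtvkl : measurable_fun [set: Om] (fun w => tv_norm (k w) (l w)).
  by apply: measurable_coarse; exact: measurable_tv_comp.
have d0 : (0 <= 2 - dobrushin Q)%R by have := dobrushin_le1 Q; lra.
rewrite (observation_integral mh h0) -ge0_integralZl//; last first.
  by move=> w _; exact: tv_norm_ge0.
apply: ae_ge0_le_integral => //.
- move=> w _; apply: integral_ge0 => y _; rewrite mule_ge0//; exact: integral_ge0.
- by move=> w _; rewrite mule_ge0//; exact: tv_norm_ge0.
- exact: measurable_funeM.
- apply: filterS kl => w [k1 l1 kl_w] _.
  rewrite (eq_integral (fun y => normalizer g (k w) y *
      tv_norm (bayes g (k w) y) (bayes g (l w) y))).
    exact: (bayes_contraction g mtv k1 l1 kl_w).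
  by move=> y _; rewrite muleC.
Qed.

End observation_step.

(** * Stability of the filter *)

Section cond_law_uniqueness.
Context d (Om : measurableType d) dZ (Z : measurableType dZ) (R : realType).
Variables (P : probability Om R) (G : set (set Om)) (V : Om -> Z).
Hypotheses (mG : G `<=` measurable) (mV : measurable_fun [set: Om] V).
Local Notation Og := (g_sigma_algebraType G).

(** Both sides are measurable for the small sigma-algebra and have the same
    integral on each of its events. *)
Lemma cond_law_ae_eq (k l : Om -> giry Z R) A :
  is_cond_law P G V k -> is_cond_law P G V l -> measurable A ->
  {ae P, forall w, k w A = l w A}.
Proof.
move=> kP lP mA; have [mk Ik] := kP _ mA; have [ml Il] := lP _ mA.
have mid := measurable_id_coarse mG.
pose PG : giry Og R := giry_map mid P.
have IPG (f : Og -> \bar R) B : measurable_fun [set: Og] f ->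
    (forall w, 0 <= f w) -> measurable (B : set Og) ->
    \int[PG]_(w in B) f w = \int[P]_(w in B) f w.
  by move=> mf f0 mB; rewrite ge0_integral_pushforward//; exact: measurable_funTS.
have [N [mN N0 hN]] : ae_eq PG setT (fun w => k w A) (fun w => l w A).
  apply: integral_ae_eq => //.
  - apply/integrableP; split => //.
    under eq_integral do rewrite gee0_abs//.
    rewrite IPG// Ik; last exact: (measurableT : measurable (setT : set Og)).
    rewrite setIT ltey_eq fin_num_measure//.
    by rewrite -[X in measurable X]setTI; exact: mV.
  - move=> B _ mB; rewrite !IPG//.
    by rewrite Ik// Il.
exists N; split => //; last by move=> w hw; apply: hN => /= h; apply: hw; exact: h.
have := mid measurableT _ mN; by rewrite setTI preimage_id.
Qed.

End cond_law_uniqueness.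

Lemma comparable_predict (R : realType) dx (X : measurableType dx)
    (T : R.-pker X ~> X) (m m' : subprobability X R) :
  comparable_probabilities m m' ->
  comparable_probabilities (predict T m) (predict T m').
Proof.
move=> [m1 m'1 mm']; split; last exact: predict_dominates.
  exact: (etrans (predict_setT T m) m1).
exact: (etrans (predict_setT T m') m'1).
Qed.

Section filter_stability.
Context (R : realType) dx dy (X : measurableType dx) (Y : measurableType dy).
Variables (T : R.-pker X ~> X) (Q : R.-pker X ~> Y).
Variables (lam : probability Y R) (g : likelihood Q lam).

Local Notation trajectory := (seqspace X * seqspace Y)%type.
Local Notation obs_events n := (events_upto (@observation _ _ X Y) n).

Let measurable_coord d (S : measurableType d) n :
  measurable_fun [set: seqspace S] (fun s : seqspace S => s n).
Proof.
move=> _ B mB; rewrite setTI; apply: sub_sigma_algebra.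
by exists n => //; exists B => //; rewrite setTI.
Qed.

Lemma measurable_state n :
  measurable_fun [set: trajectory] (state n : trajectory -> X).
Proof. exact: (measurableT_comp (measurable_coord n) measurable_fst). Qed.

Lemma measurable_observation n :
  measurable_fun [set: trajectory] (observation n : trajectory -> Y).
Proof. exact: (measurableT_comp (measurable_coord n) measurable_snd). Qed.

Lemma measurable_obs_events n : obs_events n `<=` @measurable _ trajectory.
Proof. by move=> _ [k _ [C mC <-]]; exact: measurable_observation. Qed.

Lemma events_upto0 d (S : measurableType d) (Om : Type) (Z : nat -> Om -> S) :
  events_upto Z 0 = preimage_set_system [set: Om] (Z 0%N) measurable.
Proof.
apply/seteqP; split => B; first by case=> k /=; rewrite ltnS leqn0 => /eqP ->.
by exists 0%N.
Qed.

Lemma events_uptoS d (S : measurableType d) (Om : Type) (Z : nat -> Om -> S) n :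
  events_upto Z n.+1 =
  events_upto Z n `|` preimage_set_system [set: Om] (Z n.+1) measurable.
Proof.
apply/seteqP; split => B.
  case=> k /=; rewrite ltnS leq_eqVlt => /orP[/eqP ->|kn] hk; first by right.
  by left; exists k.
case; last by exists n.+1 => /=.
by case=> k /= kn hk; exists k => //=; exact: ltnW.
Qed.

Lemma obs_events_sub n :
  <<s obs_events n >> `<=` <<s events_upto (@state_obs _ _ X Y) n >>.
Proof.
apply: smallest_sub; first exact: smallest_sigma_algebra.
move=> _ [k kn [C mC <-]]; apply: sub_sigma_algebra; exists k => //.
by exists (setT `*` C); [exact: measurableX|rewrite !setTI; apply/seteqP; split=> w // []].
Qed.

(** Time 0 is treated as an observation step with an empty past: the prediction
    is then the prior itself. *)
Lemma initial_law (mu : probability X R) (P : probability trajectory R) :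
  is_pomp_law T Q mu P ->
  is_cond_law P set0 (fun w => (state 0 w, observation 0 w))
    (fun=> joint_kernel Q mu).
Proof.
move=> [P0 _] A mA; split; first exact: measurable_cst.
move=> B GB.
have {GB} : B = set0 \/ B = setT.
  move: B GB; apply: smallest_sub => //; split.
  - by left.
  - by move=> B [->|->]; rewrite setTD ?setC0 ?setCT; [right|left].
  - move=> F hF; have [[n Fn]|h] := pselect (exists n, F n = setT).
      by right; rewrite -subTset => w _; exists n => //; rewrite Fn.
    left; rewrite -subset0 => w [n _]; case: (hF n) => [->//|Fn].
    by exfalso; apply: h; exists n.
case=> ->; first by rewrite integral_set0 setI0 measure0.
rewrite setIT (P0 _ mA) joint_kernelE//.
apply: (etrans (integral_cst P measurableT _)).
by rewrite -[RHS]mule1; congr (_ * _); exact: probability_setT.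
Qed.

(** The Markov property conditions on the past states as well; integrating the
    present state against the filter leaves the past observations only. *)
Lemma prediction_law (mu : probability X R) (P : probability trajectory R) n
    (k : trajectory -> giry X R) :
  is_pomp_law T Q mu P -> is_cond_law P (obs_events n) (state n) k ->
  is_cond_law P (obs_events n) (fun w => (state n.+1 w, observation n.+1 w))
    (fun w => joint_kernel Q (predict T (k w))).
Proof.
move=> [_ /(_ n) PS] kP A mA.
have mk := measurable_cond_law kP.
have mq : measurable_fun [set: X] (fun x => Q x (xsection A x)).
  have := measurable_fun_xsection_finite_kernel Q (A := A); rewrite inE; exact.
pose f x := \int[T x]_z Q z (xsection A z).
have mf : measurable_fun [set: X] f.
  exact: (measurableT_comp (measurable_giry_int mq _) (measurable_giry_of_kernel T)).
have f0 x : 0 <= f x by exact: integral_ge0.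
split.
  have mJ := measurableT_comp (measurable_joint_kernel Q)
    (measurableT_comp (measurable_predict T) mk).
  exact: (measurableT_comp (measurable_giry_ev mA) mJ).
move=> B GB; have [_ <-//] := PS A mA; last exact: obs_events_sub.
pose h (z : g_sigma_algebraType (obs_events n) * X) := (\1_B z.1)%:E * f z.2 : \bar R.
have mh : measurable_fun [set: g_sigma_algebraType (obs_events n) * X] h.
  apply: emeasurable_funM; last exact: measurableT_comp mf measurable_snd.
  apply/measurable_EFinP.
  exact: (measurableT_comp (measurable_indic (GB : measurable (B : set (g_sigma_algebraType _)))) measurable_fst).
have h0 z : 0 <= h z by rewrite mule_ge0// lee_fin.
transitivity (\int[P]_w h (w, state n w)); last first.
  rewrite [RHS]integral_mkcond; apply: eq_integral => w _.
  by rewrite epatch_indic muleC.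
rewrite (cond_law_integral (@measurable_obs_events n) (measurable_state n) kP mh h0).
rewrite integral_mkcond; apply: eq_integral => w _.
rewrite epatch_indic muleC.
transitivity ((\1_B w)%:E * \int[k w]_x f x); last by rewrite -ge0_integralZl.
congr (_ * _).
apply: (etrans (joint_kernelE Q (predict T (k w) : giry X R) mA)).
exact: predict_integral.
Qed.

Variable Ge : nat -> set X.
Hypothesis GeE : @measurable _ X = <<s range Ge >>.

Let mtv := @measurable_tv_norm _ X R Ge GeE.

Section fixed_law.
Variables (mu nu : probability X R) (P : probability trajectory R).
Hypotheses (munu : mu `<< nu) (PP : is_pomp_law T Q mu P).

Let Pae n := {ae P, forall w, comparable_probabilities
  (filter_rec T g mu n w) (filter_rec T g nu n w)}.

Let mset0 : (set0 : set (set trajectory)) `<=` measurable. Proof. by []. Qed.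

Let with_obs n (G : set (set trajectory)) :=
  with_events G (observation n : trajectory -> Y).

Let obs0 : obs_events 0 = with_obs 0 set0.
Proof. by rewrite /with_obs /with_events set0U events_upto0. Qed.

Let obsS n : obs_events n.+1 = with_obs n.+1 (obs_events n).
Proof. exact: events_uptoS. Qed.

(** Along the recursion, the filter started from mu is the conditional law and
    stays comparable with the one started from nu. *)
Lemma filter_invariant n :
  [/\ is_cond_law P (obs_events n) (state n) (filter_rec T g mu n),
      measurable_fun [set: g_sigma_algebraType (obs_events n)]
        (filter_rec T g nu n : _ -> giry X R) & Pae n].
Proof.
elim: n => [|n [kP ml kl]].
- have mc (m : giry X R) : measurable_fun
      [set: g_sigma_algebraType (set0 : set (set trajectory))] (fun=> m).
    exact: measurable_cst.
  have mn1 : {ae P, forall w : trajectory, comparable_probabilities mu nu}.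
    by apply: aeW => w; split=> //; exact: probability_setT.
  split.
  + rewrite obs0; exact: (bayes_cond_law g mset0 (measurable_state 0)
      (measurable_observation 0) (mc mu) (initial_law PP)).
  + rewrite obs0; apply: measurable_bayes_comp; first exact: measurable_cst.
    exact: measurable_with_events_obs.
  + exact: (comparable_bayes g mset0 (measurable_state 0)
      (measurable_observation 0) (mc mu) (initial_law PP) (mc nu) mn1).
- have mk := measurable_cond_law kP.
  have mpk := measurableT_comp (measurable_predict T) mk.
  have mpl := measurableT_comp (measurable_predict T) ml.
  have pkl : {ae P, forall w, comparable_probabilities
      (predict T (filter_rec T g mu n w)) (predict T (filter_rec T g nu n w))}.
    by move: kl; apply: filterS => w; exact: comparable_predict.
  have kS := prediction_law PP kP.
  split.
  + rewrite obsS; exact: (bayes_cond_law g (@measurable_obs_events n)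
      (measurable_state n.+1) (measurable_observation n.+1) mpk kS).
  + rewrite obsS; apply: measurable_bayes_comp.
      exact: (measurableT_comp mpl (@measurable_with_events_id _ trajectory _ Y _ _)).
    exact: measurable_with_events_obs.
  + exact: (comparable_bayes g (@measurable_obs_events n)
      (measurable_state n.+1) (measurable_observation n.+1) mpk kS mpl pkl).
Qed.

Let error n := \int[P]_w tv_norm (filter_rec T g mu n w) (filter_rec T g nu n w).

Lemma initial_error : error 0 <= (2 - dobrushin Q)%:E * tv_norm mu nu.
Proof.
have mc (m : giry X R) : measurable_fun
    [set: g_sigma_algebraType (set0 : set (set trajectory))] (fun=> m).
  exact: measurable_cst.
have mn1 : {ae P, forall w : trajectory, comparable_probabilities mu nu}.
  by apply: aeW => w; split=> //; exact: probability_setT.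
apply: (le_trans (bayes_error g mset0 (measurable_state 0)
  (measurable_observation 0) (mc mu) (initial_law PP) (mc nu) mn1 mtv)).
apply: lee_wpmul2l; first by rewrite lee_fin; have := dobrushin_le1 Q; lra.
rewrite le_eqVlt; apply/orP; left; apply/eqP.
apply: (etrans (integral_cst P measurableT _)).
rewrite -[RHS]mule1; congr (_ * _); exact: probability_setT.
Qed.

Lemma next_error n : error n.+1 <=
  ((1 - dobrushin T) * (2 - dobrushin Q))%:E * error n.
Proof.
have [kP ml kl] := filter_invariant n.
have mk := measurable_cond_law kP.
have mpk := measurableT_comp (measurable_predict T) mk.
have mpl := measurableT_comp (measurable_predict T) ml.
have pkl : {ae P, forall w, comparable_probabilities
    (predict T (filter_rec T g mu n w)) (predict T (filter_rec T g nu n w))}.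
  by move: kl; apply: filterS => w; exact: comparable_predict.
have mG := @measurable_obs_events n.
apply: (le_trans (bayes_error g mG (measurable_state n.+1)
  (measurable_observation n.+1) mpk (prediction_law PP kP) mpl pkl mtv)).
rewrite mulrC EFinM -muleA; apply: lee_wpmul2l.
  by rewrite lee_fin; have := dobrushin_le1 Q; lra.
have T0 : (0 <= 1 - dobrushin T)%R by rewrite subr_ge0 dobrushin_le1.
have mt := measurable_coarse mG (measurable_tv_comp mtv mk ml).
rewrite -ge0_integralZl//; last by move=> w _; exact: tv_norm_ge0.
apply: ae_ge0_le_integral => //.
- by move=> w _; exact: tv_norm_ge0.
- exact: (measurable_coarse mG (measurable_tv_comp mtv mpk mpl)).
- by move=> w _; rewrite mule_ge0//; exact: tv_norm_ge0.
- exact: measurable_funeM.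
- move: kl; apply: filterS => w [k1 l1 _] _; exact: predict_tv.
Qed.

(** Any version of the filter equals the one computed by the recursion, as a
    measure and outside a null event. *)
Lemma expected_errorE pi n : is_filter P pi -> expected_error T g P pi nu n = error n.
Proof.
move=> piP; have [kP ml _] := filter_invariant n.
have mG := @measurable_obs_events n.
have mk := measurable_cond_law kP.
have piPn : is_cond_law P (obs_events n) (state n) (pi n) := piP n.
have mpi := measurable_cond_law piPn.
apply: ae_eq_integral => //.
- exact: (measurable_coarse mG (measurable_tv_comp mtv mpi ml)).
- exact: (measurable_coarse mG (measurable_tv_comp mtv mk ml)).
have : {ae P, forall w j,
    pi n w (alg_seq Ge j) = filter_rec T g mu n w (alg_seq Ge j)}.
  apply/ae_foralln => j; apply: (cond_law_ae_eq mG _ piPn kP).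
    exact: measurable_state.
  exact: measurable_alg_seq.
apply: filterS => w h _; apply: eq_tv_norm => //.
apply: (eq_measure_alg_seq GeE) => //.
by rewrite ltey_eq fin_num_measure.
Qed.

End fixed_law.

End filter_stability.

Unset Implicit Arguments.

Theorem corollary3p4 (R : realType) (X Y : completePseudoMetricType R)
    (polishX : polish X) (polishY : polish Y)
    (T : R.-pker (borel X) ~> (borel X)) (Q : R.-pker (borel X) ~> (borel Y))
    (lam : probability (borel Y) R) (domQ : forall x, Q x `<< lam)
    (g : likelihood Q lam) :
  let alpha : R := ((1 - dobrushin T) * (2 - dobrushin Q))%R in
  ((alpha < 1)%R ->
     exp_stable_with T g alpha /\
     forall mu nu : probability (borel X) R, mu `<< nu ->
     forall P, is_pomp_law T Q mu P ->
     forall pi, is_filter P pi ->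
     forall n : nat,
       \int[P]_w tv_norm (pi n w) (filter_rec T g nu n w)
         <= ((2 - dobrushin Q) * alpha ^+ n)%:E * tv_norm mu nu) /\
  ((dobrushin T > 1 / 2)%R -> (alpha < 1)%R /\ exp_stable T g).
Proof.
move=> alpha; have [G GE] := borel_countably_generated polishX.
have T0 := dobrushin_ge0 T; have T1 := dobrushin_le1 T.
have Q0 := dobrushin_ge0 Q; have Q1 := dobrushin_le1 Q.
have alpha0 : (0 <= alpha)%R by apply: mulr_ge0; lra.
have stable : exp_stable_with T g alpha.
  move=> mu nu munu P PP pi piP n.
  rewrite !(expected_errorE g GE munu PP _ piP).
  exact: (next_error g GE munu PP).
split=> [_|T12].
  split=> // mu nu munu P PP pi piP; elim=> [|n IHn].
    rewrite expr0 mulr1 -/(expected_error T g P pi nu 0).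
    rewrite (expected_errorE g GE munu PP _ piP).
    exact: (initial_error g GE munu PP).
  apply: le_trans (stable mu nu munu P PP pi piP n) _.
  rewrite exprS mulrCA (EFinM alpha ((2 - dobrushin Q) * alpha ^+ n)%R) -muleA.
  by apply: lee_wpmul2l => //; rewrite lee_fin.
have alpha1 : (alpha < 1)%R.
  rewrite /alpha; nra.
(* A coefficient in the open unit interval is required, whereas alpha may be 0. *)
split=> //; exists (if alpha == 0 then 1 / 2 else alpha)%R.
case: eqVneq => [alpha_eq0|alpha_neq0]; last first.
  by split => //; rewrite alpha1 lt0r alpha_neq0 alpha0.
split; first by apply/andP; split; lra.
move=> mu nu munu P PP pi piP n.
apply: le_trans (stable mu nu munu P PP pi piP n) _.
rewrite alpha_eq0 mul0e; apply: mule_ge0; first by rewrite lee_fin; lra.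
by apply: integral_ge0 => w _; exact: tv_norm_ge0.
Qed.
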